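(* Let $B$ be a unital $*$-algebra over $\mathbf{C}$, let $(A,\mathcal{E})$ be a $B$-valued $*$-noncommutative probability space and let $a\in A$ be $B$-valued R-diagonal. For $\ell\ge1$ let $\alpha^{(1)}_\ell$ and $\alpha^{(2)}_\ell$ be the $(2\ell-1)$-multilinear $B$-valued cumulant maps of the pair $(a_1,a_2)=(a,a^* )$ corresponding to the index sequences $(1,2,1,2,\ldots,1,2)$ and $(2,1,2,1,\ldots,2,1)$ of length $2\ell$, respectively. Consider the formal power series $$F(b_1,b_2)=\sum_{n=0}^\infty\mathcal{E}((ab_1a^*b_2)^n),\qquad G(b_1,b_2)=\sum_{n=0}^\infty\mathcal{E}((a^*b_1ab_2)^n).$$ Then, as identities of formal power series in $b_1,b_2$, $$F(b_1,b_2)=1+\sum_{\ell=1}^\infty\alpha^{(1)}_\ell\Big(b_1G(b_2,b_1),\,b_2F(b_1,b_2),\,b_1G(b_2,b_1),\ldots,b_2F(b_1,b_2),\,b_1G(b_2,b_1)\Big)\,b_2F(b_1,b_2),$$ $$G(b_1,b_2)=1+\sum_{\ell=1}^\infty\alpha^{(2)}_\ell\Big(b_1F(b_2,b_1),\,b_2G(b_1,b_2),\,b_1F(b_2,b_1),\ldots,b_2G(b_1,b_2),\,b_1F(b_2,b_1)\Big)\,b_2G(b_1,b_2),$$ where in the $\ell$-th summand the $2\ell-1$ arguments of $\alpha^{(i)}_\ell$ alternate between the two displayed expressions.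
   Context: Meaning of the identities: the $n$-th term of $F$ or $G$ is regarded as homogeneous of degree $2n$ in the variables $b_1,b_2$. The right-hand sides are the formal series obtained by substituting the series $F,G$ into the multilinear maps $\alpha^{(i)}_\ell$, expanding by multilinearity, and collecting terms by degree (each variable $b_1,b_2$ displayed explicitly contributing degree 1). The identities assert that for every $n\ge0$ and all $b_1,b_2\in B$ the (finite) degree-$2n$ parts of both sides agree; no convergence is involved. A $B$-valued $*$-noncommutative probability space is a pair $(A,\mathcal{E})$ where $A$ is a unital $*$-algebra over $\mathbf{C}$ containing a unitally embedded copy of the $*$-algebra $B$ and $\mathcal{E}:A\to B$ is a $*$-preserving conditional expectation: linear, $\mathcal{E}(b)=b$ for $b\in B$, and $\mathcal{E}(b_1ab_2)=b_1\mathcal{E}(a)b_2$. R-diagonality: for $\epsilon\in\{1,*\}^n$, the maximal alternating interval partition $\sigma(\epsilon)$ is the interval partition of $\{1,\ldots,n\}$ whose blocks $V$ are the maximal intervals such that $j,j+1\in V$ implies $\epsilon(j)\neq\epsilon(j+1)$. The element $a$ is $B$-valued R-diagonal if for every $k\ge0$ and $b_1,\ldots,b_{2k}\in B$, $\mathcal{E}(ab_1a^*b_2ab_3a^*\cdots b_{2k-2}ab_{2k-1}a^*b_{2k}a)=0$, and for every $n\ge1$, $\epsilon\in\{1,*\}^n$, $b_1,\ldots,b_n\in B$, $$\mathcal{E}\Big(\prod_{V\in\sigma(\epsilon)}\Big(\Big(\prod_{j\in V}a^{\epsilon(j)}b_j\Big)-\mathcal{E}\Big(\prod_{j\in V}a^{\epsilon(j)}b_j\Big)\Big)\Big)=0,$$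 all products in order of increasing indices. (For such $a$, Śniady and Speicher showed that the only cumulant maps of $(a,a^* )$ that can be nonzero are the $\alpha^{(1)}_\ell,\alpha^{(2)}_\ell$.) Cumulants: for a family $(a_i)_{i\in I}$ in $A$ the cumulant maps $\alpha_j:B^{n-1}\to B$ ($j\in I^n$, $n\ge 1$; an element of $B$ if $n=1$) are the $\mathbf{C}$-multilinear maps defined recursively by $\mathcal{E}(a_{j(1)}b_1a_{j(2)}\cdots b_{n-1}a_{j(n)})=\sum_{\pi\in NC(n)}\hat\alpha_j(\pi)[b_1,\ldots,b_{n-1}]$, the sum being over noncrossing partitions of $\{1,\dots,n\}$. Here $\hat\alpha_j(1_n)=\alpha_j$ for the one-block partition $1_n$; if $\pi\ne1_n$, choose an interval block $\{p,\ldots,p+q-1\}$ of $\pi$, let $\pi'\in NC(n-q)$ be $\pi$ with this block removed (renumbered), $j''=(j(p),\ldots,j(p+q-1))$, and $j'$ be $j$ with these entries removed; then $\hat\alpha_j(\pi)[b_1,\ldots,b_{n-1}]$ equals $\hat\alpha_{j'}(\pi')[b_1,\ldots,b_{p-2},b_{p-1}\alpha_{j''}(b_p,\ldots,b_{p+q-2})b_{p+q-1},b_{p+q},\ldots,b_{n-1}]$ if $p\ge2$, $p+q-1<n$; $\hat\alpha_{j'}(\pi')[b_1,\ldots,b_{p-2}]\,b_{p-1}\alpha_{j''}(b_p,\ldots,b_{n-1})$ if $p\ge2$, $p+q-1=n$; $\alpha_{j''}(b_1,\ldots,b_{q-1})\,b_q\,\hat\alpha_{j'}(\pi')[b_{q+1},\ldots,b_{n-1}]$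 if $p=1$, $q<n$. *)

(* Defs.v *)
From HB Require Import structures.
From mathcomp Require Import all_boot all_order all_algebra.
From mathcomp Require Export reals complex.

Set Implicit Arguments.
Unset Strict Implicit.
Unset Printing Implicit Defensive.

Import Order.TTheory GRing.Theory Num.Theory.
Local Open Scope ring_scope.

(** * Star-algebras and B-valued star-noncommutative probability spaces *)

Record star_algebra (C : numClosedFieldType) (A : algType C) (star : A -> A)
  : Prop := StarAlgebra {
  starD : forall x y, star (x + y) = star x + star y;
  starZ : forall (c : C) x, star (c *: x) = c^* *: star x;
  starM : forall x y, star (x * y) = star y * star x;
  starK : involutive star
}.

Record star_ncps (C : numClosedFieldType) (B A : algType C)
    (starB : B -> B) (starA : A -> A)
    (iota : {lrmorphism B -> A}) (E : {linear A -> B}) : Prop := StarNcps {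
  ncps_starB : star_algebra starB;
  ncps_starA : star_algebra starA;
  ncps_iota_inj : injective iota;
  ncps_iota_star : forall b, iota (starB b) = starA (iota b);
  ncps_E_star : forall x, E (starA x) = starB (E x);
  ncps_E_id : forall b, E (iota b) = b;
  ncps_E_bimod : forall b1 x b2, E (iota b1 * x * iota b2) = b1 * E x * b2
}.

(** * Noncrossing partitions *)

Definition noncrossing n (P : {set {set 'I_n}}) : bool :=
  [forall V in P, forall W in P, (V != W) ==>
    ~~ [exists i in V, exists k in W, exists j in V, exists l in W,
         [&& i < k, k < j & j < l]%N]].

Definition NC n : {set {set {set 'I_n}}} :=
  [set P | partition P [set: 'I_n] & noncrossing P].

(** A partition of {0, ..., n-1} is turned into a word of n labels, the label
    of a position being its block. Only the kernel of the word matters (equal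
    labels = same block), so deleting a block of the partition and renumbering
    the other positions amounts to deleting its label from the word. *)
Definition labels n (P : {set {set 'I_n}}) : seq {set 'I_n} :=
  [seq pblock P i | i <- enum 'I_n].

Definition interval_label (T : eqType) (w : seq T) (x : T) : bool :=
  take (count_mem x w) (drop (index x w) w) == nseq (count_mem x w) x.

(** * Moments and cumulants
    A multilinear map B^(n-1) -> B attached to an index j in I^n is represented
    by its values al j bs with size j = n and size bs = n-1. *)

Section Cumulants.
Variables (C : numClosedFieldType) (B A : algType C).
Variables (iota : {lrmorphism B -> A}) (E : {linear A -> B}).
Variables (I : Type) (a_ : I -> A).

(** a_(j1) b1 a_(j2) b2 ... b_(n-1) a_(jn) *)
Definition word (j : seq I) (bs : seq B) : A :=
  if j is i :: j' then a_ i * \prod_(x <- zip bs j') (iota x.1 * a_ x.2)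
  else 1.

(** The extension of al to a noncrossing partition, given as a label word w.
    The block x that is removed occupies the (0-based) positions
    p, ..., p + q - 1; the value does not depend on which interval block is
    chosen, and the leftmost one is taken here. The entry of bs standing
    between the positions i and i + 1 is bs`_i. The number of steps k is at
    least the number of blocks of w in all uses. *)
Fixpoint hat_rec (T : eqType) (al : seq I -> seq B -> B) (k : nat)
    (j : seq I) (w : seq T) (bs : seq B) : B :=
  if constant w then al j bs else
  if k is k'.+1 then
    if [seq x <- w | interval_label w x] is x :: _ then
      let p := index x w in
      let q := count_mem x w in
      let j'' := take q (drop p j) in
      let j' := take p j ++ drop (p + q) j in
      let w' := [seq y <- w | y != x] in
      if p == 0%N then
        al j'' (take q.-1 bs) * bs`_q.-1 * hat_rec al k' j' w' (drop q bs)
      else if (p + q == size w)%N then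
        hat_rec al k' j' w' (take p.-1 bs) * bs`_p.-1 * al j'' (drop p bs)
      else
        hat_rec al k' j' w'
          (take p.-1 bs
           ++ (bs`_p.-1 * al j'' (take q.-1 (drop p bs)) * bs`_(p + q).-1)
           :: drop (p + q) bs)
    else 0
  else 0.

Definition hat (al : seq I -> seq B -> B) (j : seq I)
    (P : {set {set 'I_(size j)}}) (bs : seq B) : B :=
  hat_rec al (size j) j (labels P) bs.

(** The moment-cumulant formula solved for the term of the one-block
    partition; see [moment_cumulant] below. *)
Fixpoint cumulant_rec (k : nat) (j : seq I) (bs : seq B) : B :=
  if k is k'.+1 then
    E (word j bs) - \sum_(P in NC (size j) | P != [set [set: 'I_(size j)]])
                       hat (cumulant_rec k') P bs
  else 0.

Definition cumulant (j : seq I) (bs : seq B) : B := cumulant_rec (size j) j bs.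

End Cumulants.

(** * R-diagonality
    The letters 1 and * are encoded by [false] and [true]; also, the pair
    (a_1, a_2) = (a, a^* ) is indexed by [false], [true]. *)

Definition pair_star (A : Type) (star : A -> A) (a : A) (e : bool) : A :=
  if e then star a else a.

(** Cuts (e_1, b_1), ..., (e_n, b_n) along the maximal alternating interval
    partition of e: a cut occurs exactly between equal consecutive letters. *)
Fixpoint alternating_blocks (T : Type) (s : seq (bool * T))
    : seq (seq (bool * T)) :=
  if s is x :: s' then
    if alternating_blocks s' is (y :: V) :: Vs then
      if x.1 != y.1 then (x :: y :: V) :: Vs else [:: x] :: (y :: V) :: Vs
    else [:: [:: x]]
  else [::].

Record R_diagonal (C : numClosedFieldType) (B A : algType C) (starA : A -> A)
    (iota : {lrmorphism B -> A}) (E : {linear A -> B}) (a : A) : Prop :=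
  RDiagonal {
  R_diagonal_odd : forall (k : nat) (bs : k.*2.-tuple B),
    E (word iota (pair_star starA a) (mkseq odd k.*2.+1) bs) = 0;
  R_diagonal_centered : forall (n : nat) (s : n.-tuple (bool * B)), (0 < n)%N ->
    let prodV V := \prod_(x <- V) (pair_star starA a x.1 * iota x.2) in
    E (\prod_(V <- alternating_blocks s) (prodV V - iota (E (prodV V)))) = 0
}.

(** * Formal power series in two B-valued variables b1, b2
    A series is given by its homogeneous components: [s d b1 b2] is the part of
    degree d of s, evaluated at b1, b2. *)

Definition fps (B : Type) := nat -> B -> B -> B.

Section Series.
Variables (C : numClosedFieldType) (B : algType C).

Definition fps_one : fps B := fun d _ _ => if d == 0%N then 1 else 0.
Definition fps_b1 : fps B := fun d b1 _ => if d == 1%N then b1 else 0.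
Definition fps_b2 : fps B := fun d _ b2 => if d == 1%N then b2 else 0.

Definition fps_mul (s t : fps B) : fps B := fun d b1 b2 =>
  \sum_(i < d.+1) s i b1 b2 * t (d - i)%N b1 b2.

(** s(b2, b1) *)
Definition fps_swap (s : fps B) : fps B := fun d b1 b2 => s d b2 b1.

(** Substitution of series in a multilinear map: the part of degree d of
    al(s_1, ..., s_m) is the sum over e_1 + ... + e_m = d of
    al(s_1 in degree e_1, ..., s_m in degree e_m). *)
Definition fps_subst (al : seq B -> B) (ss : seq (fps B)) : fps B :=
  fun d b1 b2 =>
  \sum_(e : (size ss).-tuple 'I_d.+1 | (\sum_(i <- e) i == d)%N)
     al [seq x.1 (nat_of_ord x.2) b1 b2 | x <- zip ss e].

(** s = s0 + sum_(l >= 1) u_l: in each degree the partial sums are eventually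
    constant, equal to the corresponding component of s. *)
Definition fps_sum_from1 (s s0 : fps B) (u : nat -> fps B) : Prop :=
  forall d, exists N, forall M, (N <= M)%N -> forall b1 b2,
    s d b1 b2 = s0 d b1 b2 + \sum_(1 <= l < M.+1) u l d b1 b2.

End Series.

Arguments fps_one {C B}.
Arguments fps_b1 {C B}.
Arguments fps_b2 {C B}.

(** sum_n E((x b1 y b2)^n), the n-th term being of degree 2n *)
Definition moment_series (C : numClosedFieldType) (B A : algType C)
    (iota : {lrmorphism B -> A}) (E : {linear A -> B}) (x y : A) : fps B :=
  fun d b1 b2 =>
  if odd d then 0 else E ((x * iota b1 * y * iota b2) ^+ d./2).

(** al_l(b1 T, b2 S, b1 T, ..., b2 S, b1 T) b2 S, with 2l-1 arguments *)
Definition cumulant_term (C : numClosedFieldType) (B : algType C)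
    (al : nat -> seq B -> B) (S T : fps B) (l : nat) : fps B :=
  fps_mul
    (fps_subst (al l)
       (mkseq (fun i => if odd i then fps_mul fps_b2 S else fps_mul fps_b1 T)
          l.*2.-1))
    (fps_mul fps_b2 S).

(** * The moment-cumulant formula *)

Section MomentCumulant.
Variables (C : numClosedFieldType) (B A : algType C).
Variables (iota : {lrmorphism B -> A}) (E : {linear A -> B}).
Variables (I : Type) (a_ : I -> A).

Lemma hat_rec_eq (T : eqType) (al al' : seq I -> seq B -> B) (m k : nat)
    (j : seq I) (w : seq T) (bs : seq B) :
  (forall j' bs', (0 < size j' <= m)%N -> al j' bs' = al' j' bs') ->
  size j = size w -> (0 < size w)%N ->
  (size w <= m + ~~ constant w)%N ->
  hat_rec al k j w bs = hat_rec al' k j w bs.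
Proof.
move=> eq_al; elim: k j w bs => [|k IHk] j w bs szj w_gt0 w_le /=.
  by case: ifP w_le => // _; rewrite addn0 => w_le; rewrite eq_al // szj w_gt0.
case: ifP w_le => [_|w_nconst].
  by rewrite addn0 => w_le; rewrite eq_al // szj w_gt0.
rewrite addn1 => w_le.
case def_s: [seq x <- w | interval_label w x] => [//|x s].
have: x \in [seq x <- w | interval_label w x] by rewrite def_s mem_head.
rewrite mem_filter => /andP[/eqP int_x x_w].
have q_gt0 : (0 < count_mem x w)%N by rewrite -has_count has_pred1.
set p := index x w; set q := count_mem x w.
have szw' : (size [seq y <- w | y != x] + q = size w)%N.
  by rewrite size_filter addnC; exact: (count_predC (pred1 x)).
have pq_le : (p + q <= size w)%N.
  have := congr1 size int_x; rewrite size_nseq size_take_min size_drop.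
  move/minn_idPl; rewrite -/p -/q leq_subRL // ltnW // index_mem //.
have w'_gt0 : (0 < size [seq y <- w | y != x])%N.
  rewrite lt0n; apply/negP => /eqP/size0nil w'0.
  move: w_nconst; have: all (pred1 x) w.
    by rewrite all_count -[count _ _]/q -szw' w'0.
  by case: (w) => //= y w1 /andP[/eqP-> ->].
have szj' : size (take p j ++ drop (p + q) j) = size [seq y <- w | y != x].
  rewrite size_cat size_drop szj size_takel; last first.
    by rewrite szj (leq_trans _ pq_le) // leq_addr.
  apply/eqP; rewrite -(eqn_add2r q) szw' addnAC -{1}[size w](subnKC pq_le).
  by rewrite addKn subnKC.
have szj'' : (0 < size (take q (drop p j)) <= m)%N.
  rewrite size_takel; last first.
    by rewrite size_drop szj leq_subRL // (leq_trans _ pq_le) ?leq_addr.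
  rewrite q_gt0 -ltnS (leq_trans _ w_le) // -szw' -[X in (X < _)%N]add0n.
  by rewrite ltn_add2r.
have w'_le : (size [seq y <- w | y != x] <=
               m + ~~ constant [seq y <- w | y != x])%N.
  rewrite (leq_trans _ (leq_addr _ _)) // -ltnS (leq_trans _ w_le) //.
  by rewrite -szw' -[X in (X < _)%N]addn0 ltn_add2l.
by rewrite !(IHk (_ ++ _) _ _ szj' w'_gt0 w'_le) !(eq_al _ _ szj'').
Qed.

Lemma constant_labels n (P : {set {set 'I_n}}) :
  (0 < n)%N -> partition P [set: 'I_n] ->
  constant (labels P) = (P == [set [set: 'I_n]]).
Proof.
case: n P => // n P _ partP; have [/eqP covP trivP P0] := and3P partP.
have pbE i : pblock P i \in P by rewrite pblock_mem // covP inE.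
have iE i : i \in pblock P i by rewrite mem_pblock covP inE.
apply/idP/eqP => [|defP].
  move/(constantP set0) => [V defV].
  have pbV i : pblock P i = V.
    have /(nthP set0)[k k_lt <-] : pblock P i \in labels P.
      by apply: map_f; rewrite mem_enum.
    by rewrite {1}defV nth_nseq; move: k_lt; rewrite {1}defV size_nseq => ->.
  have VT : V = setT by apply/setP => i; rewrite inE -(pbV i) iE.
  apply/setP => W; rewrite inE -VT; apply/idP/eqP => [WP|->]; last first.
    by rewrite -(pbV ord0).
  have /set0Pn[i iW] : W != set0 by apply: contraNneq P0 => <-.
  by rewrite -(pbV i) (def_pblock trivP WP iW).
have pbT i : pblock P i = setT by have := pbE i; rewrite {2}defP inE => /eqP.
apply/(constantP set0); exists setT; rewrite /labels size_map.
by rewrite (eq_map pbT); elim: (enum _) => //= x s ->.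
Qed.

Lemma hat_eq (al al' : seq I -> seq B -> B) (j : seq I)
    (P : {set {set 'I_(size j)}}) (bs : seq B) :
  (0 < size j)%N -> P \in NC (size j) -> P != [set [set: 'I_(size j)]] ->
  (forall j' bs', (0 < size j' < size j)%N -> al j' bs' = al' j' bs') ->
  hat al P bs = hat al' P bs.
Proof.
move=> j_gt0; rewrite inE => /andP[partP _] P_n1 eq_al.
have szP : size (labels P) = size j by rewrite size_map size_enum_ord.
apply: (@hat_rec_eq _ _ _ (size j).-1) => //; rewrite ?szP //.
  move=> j' bs' /andP[j'_gt0 j'_le]; apply: eq_al.
  by rewrite j'_gt0 /= -[X in (_ < X)%N](prednK j_gt0) ltnS.
by rewrite constant_labels // P_n1 addn1 prednK.
Qed.

Lemma cumulant_rec_stable (k : nat) (j : seq I) (bs : seq B) :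
  (0 < size j <= k)%N ->
  cumulant_rec iota E a_ k j bs = cumulant iota E a_ j bs.
Proof.
elim/ltn_ind: k j bs => -[|k] IHk j bs /andP[j_gt0 j_le].
  by move: j_gt0; rewrite ltnNge j_le.
rewrite /cumulant; case def_n: (size j) => [|n]; first by rewrite def_n in j_gt0.
rewrite /=; congr (_ - _); apply: eq_bigr => P /andP[P_NC P_n1].
apply: hat_eq => // j' bs' /andP[j'_gt0]; rewrite def_n ltnS => j'_le.
have n_le : (n <= k)%N by rewrite -ltnS -def_n.
by rewrite !IHk ?j'_gt0 ?(leq_trans j'_le) // ltnS.
Qed.

Lemma moment_cumulant (j : seq I) (bs : seq B) : (0 < size j)%N ->
  E (word iota a_ j bs) =
  \sum_(P in NC (size j)) hat (cumulant iota E a_) P bs.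
Proof.
move=> j_gt0; set n := size j; have n_gt0 : (0 < n)%N by [].
have part1 : partition [set [set: 'I_n]] [set: 'I_n].
  rewrite /partition /trivIset /cover !big_set1 !eqxx /= inE eq_sym.
  by apply/set0Pn; exists (Ordinal n_gt0); rewrite inE.
have NC1 : [set [set: 'I_n]] \in NC n.
  rewrite inE part1; apply/forall_inP => V /set1P->.
  by apply/forall_inP => W /set1P->; rewrite eqxx.
rewrite (bigD1 _ NC1) /= {1}/hat.
have -> bs' : hat_rec (cumulant iota E a_) (size j) j
    (labels [set [set: 'I_n]]) bs' = cumulant iota E a_ j bs'.
  have c1 : constant (labels [set [set: 'I_n]]) by rewrite constant_labels ?eqxx.
  by case: (size j) => [|k] /=; rewrite c1.
rewrite {1}/cumulant; case def_k: (size j) => [|k].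
  by rewrite def_k in j_gt0.
rewrite /= (eq_bigr (fun P => hat (cumulant iota E a_) P bs)) ?subrK //.
move=> P /andP[P_NC P_n1]; apply: hat_eq => // j' bs' /andP[j'_gt0].
by rewrite def_k ltnS => j'_le; rewrite cumulant_rec_stable ?j'_gt0.
Qed.

End MomentCumulant.

(* Main.v *)
Require Import Defs.
From HB Require Import structures.
From mathcomp Require Import all_boot all_order all_algebra.
From mathcomp Require Import zify.
Set Implicit Arguments.
Unset Strict Implicit.
Unset Printing Implicit Defensive.
Import GRing.Theory.
Local Open Scope nat_scope.

(** The identities say that the moments of an alternating word a b1 a' b2 a b1 ...
    (a' being the adjoint of a) are obtained by summing over the outer block of
    a noncrossing partition, that is, the block V of the first letter. In the
    moment-cumulant formula, fix V and sum over the partitions of the gaps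
    between consecutive elements of V and of the part after its last element:
    since the cumulants are additive in each argument, each gap contributes its
    moment, and the result is the cumulant of the letters of V evaluated at the
    coefficients b times the moments of the gaps ([moment_sum_trees] and
    [open_sum_cons]).

    In an alternating word, a gap is again alternating. If its length is odd,
    then its moment vanishes: this is the first condition in the definition of
    R-diagonality when the gap starts with a, and its adjoint otherwise
    ([alt_moment_odd]). So only the sets V with gaps of even length contribute
    ([alt_open_sum]). Then the letters of V alternate, and their number is even
    because the whole word has even length ([alt_term_parity]). A gap after a
    letter a is a word in a', b2, a, b1, so its coefficient and moment form a
    term of b1 G(b2, b1); likewise, a letter a' of V comes with a term of
    b2 F(b1, b2), and for the last letter this is the right factor outside
    the cumulant ([alt_term_cumulant_term]). Collecting degrees gives the
    identities.

    The combinatorial part relates this to partitions as sets of blocks.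
    Noncrossing partitions of a word are in bijection with binary trees, whose
    recursive structure is the decomposition along the outer block ([sum_NC]).
    The extension of a multilinear map to a partition is given by removal of
    interval blocks; it is shown to agree with the evaluation from the outer
    block, because the latter is unchanged by such a removal
    ([hat_rec_outer]). Additivity of the cumulants follows from that of the
    moments by induction on the length ([eval_k_split]). *)

(** * Binary trees *)

(** The noncrossing partitions of a word are encoded by binary trees. In
    [Node u v], the node is the first letter of the word, [u] is the partition
    of the gap between this letter and the next letter of its block, and [v] is
    the rest of the word, which starts with that next letter (or is empty).
    The right spine is thus the outer block, and the gaps hang on its left. *)
Inductive tree := Leaf | Node of tree & tree.

Definition tree_eq_dec (s t : tree) : {s = t} + {s <> t}.
Proof. by decide equality. Defined.

HB.instance Definition _ := hasDecEq.Build tree (compareP tree_eq_dec).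

Fixpoint nodes t := if t is Node u v then (nodes u + nodes v).+1 else 0.

Fixpoint spine t := if t is Node u v then (spine v).+1 else 0.

(** the tree of the one-block partition *)
Fixpoint comb n := if n is n'.+1 then Node Leaf (comb n') else Leaf.

(** The fuel [k] is there for the sake of structural recursion: the two
    recursive calls are on [i] and [n' - i]. *)
Fixpoint trees_rec k n : seq tree :=
  if n is n'.+1 then
    if k is k'.+1 then
      [seq Node uv.1 uv.2 | i <- iota 0 n,
        uv <- [seq (u, v) | u <- trees_rec k' i, v <- trees_rec k' (n' - i)]]
    else [::]
  else [:: Leaf].

Definition trees n := trees_rec n n.

Lemma trees_recS k n : trees_rec k.+1 n.+1 =
  [seq Node uv.1 uv.2 | i <- iota 0 n.+1,
    uv <- [seq (u, v) | u <- trees_rec k i, v <- trees_rec k (n - i)]].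
Proof. by []. Qed.

Lemma mem_trees_rec k n t : n <= k -> (t \in trees_rec k n) = (nodes t == n).
Proof.
elim: k n t => [|k IHk] [|n] t; try by case: t => // *; rewrite inE.
rewrite ltnS trees_recS => le_nk; apply/allpairsPdep/eqP.
  move=> [i [[u v] []]]; rewrite mem_iota => lt_in.
  move=> /allpairsP[[u' v'] /= [u_in v_in [-> ->]]] -> /=.
  by move: u_in v_in; rewrite !IHk; lia.
case: t => // u v [def_n]; exists (nodes u), (u, v); split=> //.
  by rewrite mem_iota; lia.
by apply/allpairsP; exists (u, v); split; rewrite /= ?IHk //; lia.
Qed.

Lemma mem_trees n t : (t \in trees n) = (nodes t == n).
Proof. exact: mem_trees_rec. Qed.

Lemma uniq_trees_rec k n : n <= k -> uniq (trees_rec k n).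
Proof.
elim: k n => [|k IHk] [|n] // le_nk; rewrite trees_recS.
apply: (@allpairs_uniq_dep _ _ _ (fun (i : nat) uv => Node uv.1 uv.2)).
- exact: iota_uniq.
- move=> i; rewrite mem_iota => lt_in.
  apply: allpairs_uniq; [apply: IHk; lia | apply: IHk; lia |].
  by case=> ? ? [? ?] _ _ [] -> ->.
have nodes_fst x : x \in [seq existT (fun=> (tree * tree)%type) i uv |
    i <- iota 0 n.+1, uv <- [seq (u, v) | u <- trees_rec k i, v <- trees_rec k (n - i)]] ->
    tag x = nodes (tagged x).1.
  move=> /allpairsPdep[i [uv [+ + ->]]]; rewrite mem_iota => lt_in.
  move=> /allpairsP[[u v] [/= + _ ->]]; by rewrite mem_trees_rec; [move/eqP-> | lia].
move=> [i [u v]] [j [u' v']] /nodes_fst /= -> /nodes_fst /= -> [-> ->] //.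
Qed.

Lemma uniq_trees n : uniq (trees n).
Proof. exact: uniq_trees_rec. Qed.

Lemma perm_trees_rec k n : n <= k -> perm_eq (trees_rec k n) (trees n).
Proof.
move=> le_nk; apply: uniq_perm; rewrite ?uniq_trees ?uniq_trees_rec // => t.
by rewrite mem_trees mem_trees_rec.
Qed.

Lemma big_trees0 (V : nmodType) (f : tree -> V) :
  (\sum_(t <- trees 0) f t = f Leaf)%R.
Proof. by rewrite big_seq1. Qed.

(** The decomposition of a nonempty partition by the length [i] of the gap
    that follows the first letter. *)
Lemma big_treesS (V : nmodType) n (f : tree -> V) :
  (\sum_(t <- trees n.+1) f t =
   \sum_(i < n.+1) \sum_(u <- trees i) \sum_(v <- trees (n - i)) f (Node u v))%R.
Proof.
have def_iota : iota 0 n.+1 = index_iota 0 n.+1 by rewrite /index_iota subn0.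
rewrite /trees trees_recS big_allpairs_dep def_iota big_mkord.
apply: eq_bigr => i _; rewrite big_allpairs_dep.
rewrite (perm_big _ (@perm_trees_rec n i (ltn_ord i))); apply: eq_bigr => u _.
by rewrite (perm_big _ (perm_trees_rec (leq_subr i n))).
Qed.

Lemma nodes_comb n : nodes (comb n) = n.
Proof. by elim: n => //= n ->. Qed.

Lemma spine_le t : spine t <= nodes t.
Proof. by elim: t => //= u _ v; lia. Qed.

Lemma spine_comb t : spine t = nodes t -> t = comb (nodes t).
Proof.
elim: t => //= u _ v IHv [eq_v]; have := spine_le v; rewrite eq_v => le_uv.
have u0 : nodes u = 0 by lia.
by rewrite u0 -IHv ?eq_v ?u0 //; case: u u0 {eq_v le_uv}.
Qed.

(** * Words of labels and their shapes *)

(** A relation rather than a function on words, so that it applies to labels in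
    any type and to words that are not known to be noncrossing. The condition
    on [head x v] says that [v] is empty or begins with [x]. *)
Inductive tree_shape (T : eqType) : tree -> seq T -> Prop :=
| shape_leaf : tree_shape Leaf [::]
| shape_node x tu u tv v of
    tree_shape tu u & tree_shape tv v & x \notin u & head x v = x :
    tree_shape (Node tu tv) (x :: u ++ v).

Section Shape.
Variable T : eqType.
Implicit Types (w u v : seq T) (t : tree).

Lemma shape_ex w : exists t, tree_shape t w.
Proof.
have [n] := ubnP (size w); elim: n w => // n IHn [|x w] /= lt_wn.
  by exists Leaf; constructor.
have [tu sh_u] := IHn (take (index x w) w) ltac:(rewrite size_take_min; lia).
have [tv sh_v] := IHn (drop (index x w) w) ltac:(rewrite size_drop; lia).
exists (Node tu tv); rewrite -{1}(cat_take_drop (index x w) w).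
constructor=> //; first by rewrite in_take_leq ?index_size // ltnn.
have [x_w|] := boolP (x \in w); last first.
  by rewrite -index_mem -leqNgt => /drop_oversize ->.
by rewrite -nth0 nth_drop addn0 nth_index.
Qed.

Lemma shape_size t w : tree_shape t w -> size w = nodes t.
Proof. by elim=> //= x tu u tv v _ <- _ <- _ _; rewrite size_cat. Qed.

(** The condition on [noncrossing] partitions, read on the positions of a word;
    [d] is a default value that is never reached. *)
Definition noncrossing_word w := forall d i k j l,
  i < k -> k < j -> j < l -> l < size w ->
  nth d w i = nth d w j -> nth d w k = nth d w l -> nth d w i = nth d w k.

Lemma noncrossing_del w1 w2 w3 :
  noncrossing_word (w1 ++ w2 ++ w3) -> noncrossing_word (w1 ++ w3).
Proof.
move=> nc d i k j l ik kj jl; rewrite size_cat => lw.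
pose g i := if i < size w1 then i else size w2 + i.
have nthE p : nth d (w1 ++ w3) p = nth d (w1 ++ w2 ++ w3) (g p).
  rewrite /g !nth_cat; case: ltnP => p_lt; first by rewrite p_lt.
  by rewrite !ifF; [congr nth|..]; lia.
have g_lt p q : p < q -> g p < g q.
  by rewrite /g; case: (ltnP p (size w1)); case: (ltnP q (size w1)); lia.
rewrite !nthE; apply: nc; try exact: g_lt.
by rewrite !size_cat /g; case: (ltnP l (size w1)); lia.
Qed.

Lemma noncrossing_catl w1 w2 : noncrossing_word (w1 ++ w2) -> noncrossing_word w1.
Proof. by rewrite -{1}[w2]cats0 => /noncrossing_del; rewrite cats0. Qed.

Lemma noncrossing_catr w1 w2 : noncrossing_word (w1 ++ w2) -> noncrossing_word w2.
Proof. exact: (@noncrossing_del [::]). Qed.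

(** A label [y] common to the gap [u] and to the rest [v] would give the
    crossing pattern x y x y, since [v] begins with [x]. *)
Lemma noncrossing_disjoint x u v :
  noncrossing_word (x :: u ++ v) -> x \notin u -> head x v = x ->
  forall y, y \in u -> y \notin v.
Proof.
move=> nc xu hv y yu; apply/negP => yv.
have yx : y != x by apply: contraNneq xu => <-.
case: v hv yv nc => // z v /= ->; rewrite inE (negPf yx) /= => yv.
move=> /(_ x 0 (index y u).+1 (size u).+1 ((size u).+2 + index y v)).
rewrite /= size_cat /= !nth_cat index_mem yu ltnn subnn nth_index //.
have := yu; have := yv; rewrite -!index_mem => lt1 lt2.
rewrite ifF; last by lia.
have -> : (size u).+1 + index y v - size u = (index y v).+1 by lia.
rewrite /= nth_index // => H; case/eqP: yx; apply/esym/H; lia || by [].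
Qed.

(** In a pattern of the form y z y z, an occurrence inside the gap [u] forces
    the whole pattern inside [u]; a pattern that avoids [u] can be read in [v],
    whose head stands for the first letter [x]. *)
Lemma shape_nc x u v :
  noncrossing_word u -> noncrossing_word v -> x \notin u -> head x v = x ->
  (forall y, y \in u -> y \notin v) -> noncrossing_word (x :: u ++ v).
Proof.
move=> nc_u nc_v xu hv uv d i k j l ik kj jl /=; rewrite size_cat => lw.
set w := x :: u ++ v.
have in_u p : 0 < p <= size u -> nth d w p = nth d u p.-1 /\ nth d w p \in u.
  case: p => // p /= p_le; rewrite nth_cat p_le; split=> //; exact: mem_nth.
have in_v p : size u < p < (size u + size v).+1 ->
    nth d w p = nth d v (p - (size u).+1) /\ nth d w p \in v.
  case: p => // p /= p_le; rewrite nth_cat ifF; last by lia.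
  by rewrite subSS; split=> //; apply: mem_nth; lia.
have notin_u p : (p == 0) || (size u < p < (size u + size v).+1) ->
    nth d w p \notin u.
  case/orP => [/eqP->//|/in_v[_]]; apply: contraL; exact: uv.
have head_v : 0 < size v -> nth d v 0 = x by case: (v) hv.
have cases p : p < (size u + size v).+1 ->
  0 < p <= size u \/ (p == 0) || (size u < p < (size u + size v).+1) by lia.
move=> eij ekl.
have [ui|ui] := cases i ltac:(lia).
  have [uj|/notin_u] := cases j ltac:(lia); last by rewrite -eij (in_u _ ui).2.
  have uk : 0 < k <= size u by lia.
  have [ul|/notin_u] := cases l ltac:(lia); last by rewrite -ekl (in_u _ uk).2.
  move: eij ekl; rewrite (in_u _ ui).1 (in_u _ uj).1 (in_u _ uk).1 (in_u _ ul).1.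
  by apply: nc_u; lia.
have uk : size u < k < (size u + size v).+1.
  have [uk|] := cases k ltac:(lia); last by lia.
  have [ul|/notin_u] := cases l ltac:(lia); last by rewrite -ekl (in_u _ uk).2.
  by have := notin_u _ ui; rewrite eij (in_u j ltac:(lia)).2.
have uj : size u < j < (size u + size v).+1 by lia.
have ul : size u < l < (size u + size v).+1 by lia.
move: eij ekl; rewrite (in_v _ uk).1 (in_v _ uj).1 (in_v _ ul).1.
case/orP: ui => [/eqP i0|ui]; last first.
  by rewrite (in_v _ ui).1; apply: nc_v; lia.
rewrite i0 /w /= -head_v; last by lia.
have [->|k_gt] := posnP (k - (size u).+1); first by [].
by apply: nc_v; lia.
Qed.

(** The canonical representative of the words with a given kernel: each letter
    is replaced by the position of its first occurrence. *)
Definition canon w := [seq index y w | y <- w].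

End Shape.

(** The canonical word of a tree, for a word that starts at position [p] in a
    block first seen at position [x]; at the start of a block, [x = p]. *)
Fixpoint tree_word (x p : nat) t : seq nat :=
  if t is Node u v then
    x :: tree_word p.+1 p.+1 u ++ tree_word x (p.+1 + nodes u) v
  else [::].

Lemma size_tree_word x p t : size (tree_word x p t) = nodes t.
Proof. by elim: t x p => //= u IHu v IHv x p; rewrite size_cat IHu IHv. Qed.

Lemma mem_tree_word x p t y :
  y \in tree_word x p t -> (0 < nodes t) && ((y == x) || (p <= y < p + nodes t)).
Proof.
elim: t x p => //= u IHu v IHv x p; rewrite inE mem_cat.
case/or3P => [->//|/IHu|/IHv]; lia.
Qed.

Lemma head_tree_word x p t : head x (tree_word x p t) = x.
Proof. by case: t. Qed.

(** The length of the left subtree is recovered as the distance between the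
    first two occurrences of [x], or as the length of the tail if [x] occurs only
    once. *)
Lemma tree_word_inj x p t t' : x <= p ->
  nodes t = nodes t' -> tree_word x p t = tree_word x p t' -> t = t'.
Proof.
elim: t t' x p => [|u IHu v IHv] [|u' v'] //= x p le_xp [szE] [].
have find_u w1 w2 : index x
    (tree_word p.+1 p.+1 w1 ++ tree_word x (p.+1 + nodes w1) w2) = nodes w1.
  rewrite index_cat ifN; last first.
    by apply/negP => /mem_tree_word; lia.
  by rewrite size_tree_word; case: w2 => [|? ?] /=; rewrite ?eqxx addn0.
move=> eq_w; have szu : nodes u = nodes u' by rewrite -(find_u u v) eq_w find_u.
move/eqP: eq_w; rewrite eqseq_cat ?size_tree_word // => /andP[/eqP eq_u /eqP].
rewrite (IHu _ _ _ _ _ eq_u) // => eq_v; congr Node.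
by apply: IHv eq_v; lia.
Qed.

Lemma shape_tree_word x p t : x <= p -> tree_shape t (tree_word x p t).
Proof.
elim: t x p => [|u IHu v IHv] x p le_xp /=; first by constructor.
constructor; [by apply: IHu| by apply: IHv; lia| |exact: head_tree_word].
by apply/negP => /mem_tree_word; lia.
Qed.

Lemma noncrossing_tree_word x p t : x <= p -> noncrossing_word (tree_word x p t).
Proof.
elim: t x p => [|u IHu v IHv] x p le_xp //=.
apply: shape_nc; [by apply: IHu | by apply: IHv; lia | | exact: head_tree_word |].
  by apply/negP => /mem_tree_word; lia.
by move=> y /mem_tree_word y_u; apply/negP => /mem_tree_word; lia.
Qed.

(** The kernel of a noncrossing word is determined by its tree. The statement is
    proved for a word at position [p] whose first letter was already seen at
    position [x], which is the situation of the right subtrees. *)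
Lemma shape_canon (T : eqType) t (w : seq T) :
  tree_shape t w -> noncrossing_word w -> canon w = tree_word 0 0 t.
Proof.
suff gen : forall x0 x p, tree_shape t w -> noncrossing_word w ->
    [seq (if y == head x0 w then x else p + index y w) | y <- w]
      = tree_word x p t.
  move=> sh nc; case: w sh nc gen => [|z w] sh nc gen; first by inversion sh.
  rewrite -(gen z 0 0) //; apply: eq_map => y /=.
  by rewrite eq_sym; case: eqP.
move=> x0 x p sh; elim: sh x0 x p => //= {t w} z tu u tv v sh_u IHu _ IHv zu hv.
move=> x0 x p nc; rewrite eqxx map_cat; congr (_ :: _ ++ _).
  rewrite -(IHu z); last by move: nc; rewrite -cat1s => /noncrossing_catr/noncrossing_catl.
  apply/eq_in_map => y y_u.
  have yz : (y == z) = false by apply/eqP => def_y; rewrite -def_y y_u in zu.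
  rewrite yz eq_sym yz index_cat y_u; case: (u) y_u => //= y0 u0 _.
  by rewrite eq_sym; case: eqP => _; lia.
rewrite -(IHv z); last by move: nc; rewrite -cat1s => /noncrossing_catr/noncrossing_catr.
rewrite hv; apply/eq_in_map => y y_v; case: eqP => // /eqP yz.
rewrite eq_sym (negPf yz) index_cat ifN; last first.
  by apply: contraL y_v; exact: (noncrossing_disjoint nc).
by rewrite (shape_size sh_u); lia.
Qed.

(** * Noncrossing partitions and binary trees *)

Section NCSum.
Variable n : nat.
Implicit Types P : {set {set 'I_n}}.

Lemma nth_labels d P (i : 'I_n) : nth d (labels P) i = pblock P i.
Proof. by rewrite (nth_map i) ?size_enum_ord // nth_ord_enum. Qed.

Lemma size_labels P : size (labels P) = n.
Proof. by rewrite size_map size_enum_ord. Qed.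

Lemma noncrossing_labels P :
  partition P [set: 'I_n] ->
  noncrossing P <-> noncrossing_word (labels P).
Proof.
move=> partP; have [/eqP covP trivP P0] := and3P partP.
have inP i : pblock P i \in P by rewrite pblock_mem // covP inE.
have iP i : i \in pblock P i by rewrite mem_pblock covP inE.
split=> [/forall_inP ncP d i k j l ik kj jl|nc].
  rewrite size_labels => ln.
  have [lti ltk ltj] : [/\ i < n, k < n & j < n] by split; lia.
  rewrite (nth_labels d P (Ordinal lti)) (nth_labels d P (Ordinal ltk)).
  rewrite (nth_labels d P (Ordinal ltj)) (nth_labels d P (Ordinal ln)).
  move=> eij ekl; apply/eqP; apply: contraT => neq.
  have /forall_inP/(_ _ (inP (Ordinal ltk)))/implyP/(_ neq) := ncP _ (inP (Ordinal lti)).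
  case/negP; apply/exists_inP; exists (Ordinal lti) => //.
  apply/exists_inP; exists (Ordinal ltk) => //.
  apply/exists_inP; exists (Ordinal ltj); first by rewrite eij.
  apply/exists_inP; exists (Ordinal ln); first by rewrite ekl.
  by rewrite /= ik kj.
apply/forall_inP => V VP; apply/forall_inP => W WP; apply/implyP; apply: contraNN.
case/exists_inP => i iV /exists_inP[k kW /exists_inP[j jV /exists_inP[l lW]]].
case/and3P=> ik kj jl; have := nc V _ _ _ _ ik kj jl.
rewrite size_labels !nth_labels (def_pblock trivP VP iV) (def_pblock trivP VP jV).
by rewrite (def_pblock trivP WP kW) (def_pblock trivP WP lW) => ->.
Qed.

Lemma nth_canon (T : eqType) d (w : seq T) i : i < size w ->
  nth 0 (canon w) i = index (nth d w i) w.
Proof. by move=> lt_i; rewrite (nth_map d). Qed.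

Lemma eq_nth_canon (T : eqType) d (w : seq T) i j : i < size w -> j < size w ->
  (nth 0 (canon w) i == nth 0 (canon w) j) = (nth d w i == nth d w j).
Proof.
move=> lt_i lt_j; rewrite !(nth_canon d) //; apply/eqP/eqP => [|-> //].
by move/(congr1 (nth d w)); rewrite !nth_index ?mem_nth.
Qed.

Lemma canon_labels_inj P Q :
  partition P [set: 'I_n] -> partition Q [set: 'I_n] ->
  canon (labels P) = canon (labels Q) -> P = Q.
Proof.
move=> partP partQ eq_c.
rewrite -(preim_partition_pblock partP) -(preim_partition_pblock partQ).
apply: eq_in_imset => i _; apply/setP => j; rewrite !inE.
have kerE R : (pblock R i == pblock R j) =
    (nth 0 (canon (labels R)) i == nth 0 (canon (labels R)) j).
  by rewrite (eq_nth_canon set0) ?size_labels // !nth_labels.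
by rewrite !kerE eq_c.
Qed.

(** The partition of a tree is the partition into fibres of its word. *)
Lemma labels_surj t : nodes t = n ->
  exists2 P, P \in NC n & canon (labels P) = tree_word 0 0 t.
Proof.
move=> szt; set w := tree_word 0 0 t; have szw : size w = n by rewrite size_tree_word.
pose P := preim_partition (fun i : 'I_n => nth 0 w i) [set: 'I_n].
have partP : partition P [set: 'I_n] := preim_partitionP _ _.
have ncw : noncrossing_word w by exact: noncrossing_tree_word.
have kerP (i j : 'I_n) : (pblock P i == pblock P j) = (nth 0 w i == nth 0 w j).
  have [/eqP covP trivP _] := and3P partP.
  rewrite eq_pblock // ?covP ?inE // pblock_equivalence_partition ?inE //.
  by split=> // /eqP->.
exists P.
  rewrite inE partP /=; apply/noncrossing_labels => // d i k j l ik kj jl.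
  rewrite size_labels => ln.
  have [lti ltk ltj] : [/\ i < n, k < n & j < n] by split; lia.
  rewrite (nth_labels d P (Ordinal lti)) (nth_labels d P (Ordinal ltk)).
  rewrite (nth_labels d P (Ordinal ltj)) (nth_labels d P (Ordinal ln)).
  move=> /eqP + /eqP +; rewrite !kerP => /eqP eij /eqP ekl.
  by apply/eqP; rewrite kerP; apply/eqP; apply: ncw ik kj jl _ _ _; rewrite ?szw.
have <- : canon w = w.
  by apply: shape_canon => //; exact: shape_tree_word.
apply: (@eq_from_nth _ 0); rewrite !size_map -enumT size_enum_ord ?szw // => i lt_i.
rewrite (nth_canon set0) ?size_labels // (nth_canon 0) ?szw //.
rewrite (nth_labels _ _ (Ordinal lt_i)) /= /labels.
have {2}-> : w = [seq nth 0 w (val j) | j <- enum 'I_n].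
  rewrite map_comp val_enum_ord; apply: (@eq_from_nth _ 0) => [|k ltk].
    by rewrite size_map size_iota.
  by rewrite (nth_map 0) ?size_iota -?szw // nth_iota.
rewrite /index !find_map; apply: eq_find => j /=.
by rewrite (kerP j (Ordinal lt_i)).
Qed.

(** Both [P |-> canon (labels P)] on noncrossing partitions and the words of
    trees enumerate without repetition the same canonical words, so a sum over
    noncrossing partitions is a sum over trees. *)
Lemma sum_NC (V : nmodType) (f : {set {set 'I_n}} -> V) (g : tree -> V) :
  (forall P t, P \in NC n -> noncrossing_word (labels P) ->
     tree_shape t (labels P) -> f P = g t) ->
  (\sum_(P in NC n) f P = \sum_(t <- trees n) g t)%R.
Proof.
move=> fg; pose tw := tree_word 0 0.
pose G w := g (nth Leaf (trees n) (find (fun t => tw t == w) (trees n))).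
have tw_inj : {in trees n &, injective tw}.
  by move=> s t; rewrite !mem_trees => /eqP<- /eqP ? /tree_word_inj->.
have GE t : t \in trees n -> G (tw t) = g t.
  move=> t_n; have has_t : has (fun s => tw s == tw t) (trees n).
    by apply/hasP; exists t.
  congr g; apply: tw_inj => //; first by rewrite mem_nth // -has_find.
  exact/eqP/(nth_find Leaf has_t).
have partP P : P \in NC n -> partition P [set: 'I_n] by rewrite inE => /andP[].
have perm : perm_eq [seq canon (labels P) | P <- enum (NC n)] [seq tw t | t <- trees n].
  apply: uniq_perm.
  - rewrite map_inj_in_uniq ?enum_uniq // => P Q; rewrite !mem_enum => /partP ? /partP ?.
    exact: canon_labels_inj.
  - by rewrite map_inj_in_uniq ?uniq_trees.
  move=> w; apply/mapP/mapP => [[P]|[t]].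
    rewrite mem_enum => P_nc ->; have [t sh] := shape_ex (labels P).
    exists t; first by rewrite mem_trees -(shape_size sh) size_labels.
    apply: shape_canon => //; apply/noncrossing_labels; first exact: partP.
    by move: P_nc; rewrite inE => /andP[].
  rewrite mem_trees => /eqP/labels_surj[P P_nc eqP] ->; exists P => //.
  by rewrite mem_enum.
transitivity (\sum_(w <- [seq canon (labels P) | P <- enum (NC n)]) G w)%R.
  rewrite big_map big_enum; apply: eq_bigr => P P_nc.
  have [t sh] := shape_ex (labels P).
  have nc : noncrossing_word (labels P).
    by apply/noncrossing_labels; [exact: partP | move: P_nc; rewrite inE => /andP[]].
  rewrite (shape_canon sh nc) GE ?(fg P t) //.
  by rewrite mem_trees -(shape_size sh) size_labels.
rewrite (perm_big _ perm) big_map big_seq [RHS]big_seq.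
by apply: eq_bigr => t; exact: GE.
Qed.

End NCSum.

(** * Evaluating a noncrossing partition through its outer block *)

Section IntervalBlocks.
Variable T : eqType.
Implicit Types (w u v : seq T) (t : tree).

Lemma cat_eq_split u v u' v' : u ++ v = u' ++ v' -> size u <= size u' ->
  exists2 e, u' = u ++ e & v = e ++ v'.
Proof.
move=> eq_uv le_u; exists (drop (size u) u').
  rewrite -{1}(cat_take_drop (size u) u'); congr (_ ++ _).
  by rewrite -(takel_cat v' le_u) -eq_uv take_size_cat.
rewrite -(drop_size_cat v (erefl (size u))) eq_uv drop_cat.
by case: ltngtP le_u => // eq_sz _; rewrite eq_sz subnn drop0 drop_size.
Qed.

Lemma tree_shape_cons t x w : tree_shape t (x :: w) ->
  exists tu u tv v, [/\ t = Node tu tv, w = u ++ v, tree_shape tu u &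
    [/\ tree_shape tv v, x \notin u & head x v = x]].
Proof.
by move=> sh; inversion sh; subst; do 4!eexists; split; try split; eauto.
Qed.

Lemma tree_shape_nil t : tree_shape t ([::] : seq T) -> t = Leaf.
Proof. by move=> sh; inversion sh. Qed.

Lemma index_block w1 q y w2 : 0 < q -> y \notin w1 ->
  index y (w1 ++ nseq q y ++ w2) = size w1.
Proof.
by case: q => // q _ y1; rewrite index_cat (negPf y1) /= eqxx addn0.
Qed.

Lemma count_block w1 q y w2 : y \notin w1 -> y \notin w2 ->
  count_mem y (w1 ++ nseq q y ++ w2) = q.
Proof.
move=> /count_memPn y1 /count_memPn y2.
by rewrite !count_cat y1 y2 count_nseq /= eqxx; lia.
Qed.

Lemma interval_labelP w y : y \in w -> interval_label w y ->
  exists w1 q w2, [/\ w = w1 ++ nseq q y ++ w2, 0 < q, y \notin w1 & y \notin w2].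
Proof.
move=> y_w /eqP int_y; pose p := index y w; pose q := count_mem y w.
have q_gt0 : 0 < q by rewrite -has_count has_pred1.
exists (take p w), q, (drop q (drop p w)).
have def_w : w = take p w ++ nseq q y ++ drop q (drop p w).
  by rewrite -{1}int_y !cat_take_drop.
have y1 : y \notin take p w by rewrite in_take_leq ?index_size // ltnn.
split=> //; apply/count_memPn.
have := congr1 (count_mem y) def_w; rewrite !count_cat count_nseq /= eqxx -/q.
by lia.
Qed.

Lemma interval_block w1 q y w2 : y \notin w1 -> y \notin w2 -> 0 < q ->
  interval_label (w1 ++ nseq q y ++ w2) y.
Proof.
move=> y1 y2 q_gt0; rewrite /interval_label index_block // count_block //.
by rewrite drop_size_cat // take_size_cat ?size_nseq.
Qed.

(** An innermost block is found by descending into a nonempty gap [u]; if the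
    gap is empty, the search goes on in [v], and the block found there is
    either the outer one, to which the first letter is added, or inside. *)
Lemma interval_ex w : noncrossing_word w -> w != [::] ->
  exists2 y, y \in w & interval_label w y.
Proof.
move=> nc w_n0; have [t sh] := shape_ex w.
suff [w1 [q [y [w2 [-> q_gt0 y1 y2]]]]] : exists w1 q y w2,
    [/\ w = w1 ++ nseq q y ++ w2, 0 < q, y \notin w1 & y \notin w2].
  exists y; last exact: interval_block.
  by case: (q) q_gt0 => // q' _; rewrite mem_cat /= inE eqxx orbT.
elim: sh nc w_n0 => // {t w} x tu u tv v _ IHu _ IHv xu hv nc _.
have [u0|u_n0] := eqVneq u [::].
  rewrite u0 /=; case: v hv IHv nc => [|z v] /= hv IHv nc.
    by exists [::], 1, x, [::].
  have [|//|w1 [q [y [w2 [def_v q_gt0 y1 y2]]]]] := IHv.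
    by move: nc; rewrite u0 -cat1s => /noncrossing_catr.
  case: w1 def_v y1 => [|z1 w1] def_v y1.
    exists [::], q.+1, y, w2; split=> //=; rewrite def_v.
    by case: q q_gt0 def_v => // q _ [<- _]; rewrite -hv.
  exists (x :: z1 :: w1), q, y, w2; split=> //; first by rewrite def_v.
  rewrite inE negb_or y1 andbT; apply: contraNneq y1 => ->.
  by case: def_v => <- _; rewrite hv mem_head.
have [|//|w1 [q [y [w2 [def_u q_gt0 y1 y2]]]]] := IHu.
  by move: nc; rewrite -cat1s => /noncrossing_catr/noncrossing_catl.
have y_u : y \in u.
  by rewrite def_u; case: q q_gt0 def_u => // q _ _; rewrite mem_cat inE eqxx orbT.
exists (x :: w1), q, y, (w2 ++ v); split=> //; first by rewrite def_u /= !catA.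
  by rewrite inE negb_or y1 andbT; apply: contraNneq xu => <-.
by rewrite mem_cat negb_or y2 (noncrossing_disjoint nc).
Qed.

End IntervalBlocks.

Section Outer.
Local Open Scope ring_scope.
Variables (C : numClosedFieldType) (B : algType C) (I : Type).
Variable al : seq I -> seq B -> B.
Implicit Types s : seq (I * B).

(** A word with coefficients is a sequence of pairs [(i, b)], so that each letter
    is followed by a coefficient, the last one included; a multilinear map is
    then extended by right multiplication by this last coefficient. With this
    convention the three cases in the removal of an interval block become one:
    the value of the block multiplies the coefficient on its left. *)
Definition eval_block s : B :=
  if s is [::] then 1
  else al (unzip1 s) (take (size s).-1 (unzip2 s)) * last 1 (unzip2 s).

(** The outer block of the partition [t] of the word [s], where the value of each
    gap has been absorbed by the coefficient on its left. Hence
    [eval_block (outer_block t s)] is the multiplicative extension of [al] to the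
    partition, computed from the outer block inwards. *)
Fixpoint outer_block t s : seq (I * B) :=
  match t, s with
  | Node u v, (i, b) :: s' =>
    (i, b * eval_block (outer_block u (take (nodes u) s'))) :: outer_block v (drop (nodes u) s')
  | _, _ => [::]
  end.

Fixpoint mul_last (c : B) s :=
  match s with
  | [::] => [::]
  | (i, b) :: s' => if s' is [::] then [:: (i, b * c)] else (i, b) :: mul_last c s'
  end.

Lemma mul_last_rcons c s i b : mul_last c (rcons s (i, b)) = rcons s (i, b * c).
Proof. by elim: s => //= -[j d] s ->; case: s. Qed.

Lemma size_mul_last c s : size (mul_last c s) = size s.
Proof. by case/lastP: s => // s [i b]; rewrite mul_last_rcons !size_rcons. Qed.

Lemma mul_last_cat c s s' : s' <> [::] -> mul_last c (s ++ s') = s ++ mul_last c s'.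
Proof.
by case/lastP: s' => // s' [i b] _; rewrite -rcons_cat !mul_last_rcons rcons_cat.
Qed.

Lemma eval_block_rcons s i b :
  eval_block (rcons s (i, b)) = al (rcons (unzip1 s) i) (unzip2 s) * b.
Proof.
rewrite /eval_block; case def_s: (rcons s (i, b)) => [|x s'].
  by case: (s) def_s.
rewrite -def_s size_rcons /unzip1 /unzip2 !map_rcons last_rcons -(cats1 (map snd s)).
by rewrite take_size_cat // size_map.
Qed.

Lemma eval_block_mul_last c s : s <> [::] -> eval_block (mul_last c s) = eval_block s * c.
Proof.
by case/lastP: s => // s [i b] _; rewrite mul_last_rcons !eval_block_rcons mulrA.
Qed.

Lemma mul_last1 s : mul_last 1 s = s.
Proof. by case/lastP: s => // s [i b]; rewrite mul_last_rcons mulr1. Qed.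

(** If the interval block [sY] is the first one, then it is the outer block, and
    all that follows is its last gap. *)
Lemma outer_first (T : eqType) t q (y : T) w sY s :
  tree_shape t (nseq q y ++ w) -> (0 < q)%N -> y \notin w ->
  size sY = q -> size s = size w ->
  exists2 t', tree_shape t' w
    & outer_block t (sY ++ s) = mul_last (eval_block (outer_block t' s)) sY.
Proof.
elim: q t sY => // q IHq t sY /=; case: sY => // -[i b] sY + _ yw [] szY szs.
move=> /tree_shape_cons[tu [u [tv [v [-> eq_w sh_u [sh_v yu hv]]]]]].
case: q IHq szY eq_w => [|q] IHq szY eq_w /=.
  have {}eq_w : w = u ++ v := eq_w; have v0 : v = [::].
    case: v hv eq_w {sh_v} => // z v /= -> eq_w; case/negP: yw.
    by rewrite eq_w mem_cat mem_head orbT.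
  rewrite v0 cats0 in eq_w; case: sY szY => // _.
  exists tu; first by rewrite eq_w.
  move: sh_v; rewrite v0 => /tree_shape_nil-> /=.
  have szu : nodes tu = size s by rewrite -(shape_size sh_u) szs eq_w.
  by rewrite szu take_size.
have u0 : u = [::].
  by case: u eq_w yu {sh_u} => // z u [<-]; rewrite mem_head.
move: sh_u; rewrite u0 => /tree_shape_nil->; rewrite take0 drop0 mulr1.
have {}eq_w : nseq q.+1 y ++ w = v by rewrite -[v]/([::] ++ v) -u0.
have [||//|//|//|t' sh' eq_o] := IHq tv sY; rewrite ?eq_w //.
by exists t' => //; rewrite eq_o; case: (sY) szY.
Qed.

(** An interval block other than the first one lies inside one gap or inside the
    rest of the word, and it can be removed there by induction; if it is at the
    beginning of a gap, its value goes to the outer letter just before. *)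
Lemma outer_remove (T : eqType) t (w : seq T) : tree_shape t w ->
  forall w1 q y w2 s1 sY s2, w = w1 ++ nseq q y ++ w2 -> w1 <> [::] ->
  (0 < q)%N -> y \notin w1 -> y \notin w2 ->
  size s1 = size w1 -> size sY = q -> size s2 = size w2 ->
  exists2 t', tree_shape t' (w1 ++ w2)
    & outer_block t (s1 ++ sY ++ s2) = outer_block t' (mul_last (eval_block sY) s1 ++ s2).
Proof.
elim=> {t w} [|x tu u tv v sh_u IHu sh_v IHv xu hv] w1 q y w2 s1 sY s2.
  by case: w1.
case: w1 => [|x1 w1] //= -[<-] {x1} eq_w _ q_gt0; rewrite inE negb_or => /andP[yx y1] y2.
case: s1 => // -[i b] s1 /= [sz1] szY sz2.
(* The block is inside the gap, or after it: it cannot overlap the beginning of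
   the rest, which is a letter of the outer block. *)
have [le_u|lt_u] := leqP (size w1 + q) (size u).
  have [||u2 def_u def_w2] := @cat_eq_split _ (w1 ++ nseq q y) w2 u v.
  - by rewrite -catA eq_w.
  - by rewrite size_cat size_nseq.
  rewrite -catA in def_u; pose su := take (size u2) s2; pose sv := drop (size u2) s2.
  have def_s2 : s2 = su ++ sv by rewrite cat_take_drop.
  have szu : size su = size u2 by rewrite size_takel // sz2 def_w2 size_cat; lia.
  have y_u2 : y \notin u2 by apply: contra y2; rewrite def_w2 mem_cat => ->.
  have szuu : nodes tu = size (s1 ++ sY ++ su).
    by rewrite -(shape_size sh_u) def_u !size_cat sz1 szY szu size_nseq.
  rewrite def_s2 !catA -(catA s1) take_size_cat // drop_size_cat //.
  case: w1 s1 sz1 {eq_w le_u} def_u y1 szuu => [|z1 w1] [|z s1] // sz1 def_u y1 szuu.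
    rewrite def_u /= in sh_u szuu *.
    have [//|//|t' sh' ->] := @outer_first _ tu q y u2 sY su sh_u q_gt0 y_u2.
    exists (Node t' tv) => /=.
      rewrite def_w2; constructor=> //.
      by apply: contra xu; rewrite def_u !mem_cat => ->; rewrite !orbT.
    rewrite -(shape_size sh') take_size_cat // drop_size_cat //.
    by rewrite eval_block_mul_last ?mulrA //; case: (sY) szY q_gt0 => //= <-.
  have [//|t' sh' eq_o] := IHu _ q y u2 (z :: s1) sY su def_u _ q_gt0 y1 y_u2 sz1 szY szu.
  rewrite eq_o; exists (Node t' tv).
    rewrite def_w2 /= -cat_cons catA; constructor=> //.
    by apply: contra xu; rewrite def_u !mem_cat => /orP[] ->; rewrite ?orbT.
  have sz' : nodes t' = size (mul_last (eval_block sY) (z :: s1) ++ su).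
    by rewrite -(shape_size sh') !size_cat size_mul_last szu sz1.
  case def_m : (mul_last _ _) sz' => [|z' s'] sz'.
    by have := size_mul_last (eval_block sY) (z :: s1); rewrite def_m.
  rewrite -def_m in sz' *; rewrite /= -/(mul_last _ (z :: s1)).
  case: z def_m sz' {eq_o szuu sz1} => iz bz def_m sz'.
  by rewrite -!catA catA take_size_cat // drop_size_cat.
have [e def_w1 def_v] : exists2 e, w1 = u ++ e & v = e ++ nseq q y ++ w2.
  have [le_u|lt_u'] := leqP (size u) (size w1); first exact: cat_eq_split.
  have [|e def_u eq_v] := cat_eq_split (esym eq_w); first exact: ltnW.
  have [|f def_n def_v] := cat_eq_split (esym eq_v).
    by rewrite size_nseq; move: lt_u; rewrite def_u size_cat; lia.
  case: f def_n def_v => [|z f] def_n def_v.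
    have := congr1 size def_n; rewrite cats0 size_nseq => sz_e.
    by move: lt_u; rewrite def_u size_cat sz_e ltnn.
  have : z \in nseq q y by rewrite def_n mem_cat mem_head orbT.
  rewrite mem_nseq => /andP[_ /eqP def_z].
  by move: hv yx; rewrite def_v /= -def_z => ->; rewrite eqxx.
have e_n0 : e <> [::].
  by move=> e0; move: hv yx; rewrite def_v e0; case: (q) q_gt0 => //= ? _ ->; rewrite eqxx.
have ye : y \notin e by apply: contra y1; rewrite def_w1 mem_cat => ->; rewrite orbT.
pose su := take (size u) s1; pose se := drop (size u) s1.
have def_s1 : s1 = su ++ se by rewrite cat_take_drop.
have szu : size su = size u by rewrite size_takel // sz1 def_w1 size_cat; lia.
have sze : size se = size e by rewrite size_drop sz1 def_w1 size_cat; lia.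
have se_n0 : se <> [::] by case: (se) sze => //; case: (e) e_n0.
have [t' sh' eq_o] := IHv _ _ _ _ _ _ _ def_v e_n0 q_gt0 ye y2 sze szY sz2.
exists (Node tu t').
  rewrite def_w1 -catA; constructor=> //.
  by move: hv; rewrite def_v; case: (e) e_n0.
rewrite def_s1.
rewrite -[(if _ is [::] then _ else _)]/(mul_last (eval_block sY) ((i, b) :: su ++ se)).
rewrite -cat_cons mul_last_cat //= -!catA -(shape_size sh_u) -szu.
by rewrite !take_size_cat ?drop_size_cat // eq_o.
Qed.

Lemma unzip1_mul_last c s : unzip1 (mul_last c s) = unzip1 s.
Proof.
case/lastP: s => // s [i b].
by rewrite mul_last_rcons /unzip1 !map_rcons.
Qed.

Lemma unzip2_mul_last c s : s <> [::] -> unzip2 (mul_last c s) =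
  rcons (take (size s).-1 (unzip2 s)) (last 1 (unzip2 s) * c).
Proof.
case/lastP: s => // s [i b] _; rewrite mul_last_rcons /unzip2 !map_rcons last_rcons.
by rewrite size_rcons -(cats1 _ b) take_size_cat // size_map.
Qed.

Lemma take_unzip2 s1 s2 : s2 <> [::] ->
  take (size (s1 ++ s2)).-1 (unzip2 (s1 ++ s2)) =
  unzip2 s1 ++ take (size s2).-1 (unzip2 s2).
Proof.
case: s2 => // x s2 _; rewrite /unzip2 size_cat addnS map_cat take_cat size_map.
by rewrite ltnNge leq_addr addKn.
Qed.

Lemma nth_last_cat (b1 b2 : seq B) n : n = size b1 -> b1 <> [::] ->
  nth 0 (b1 ++ b2) n.-1 = last 1 b1.
Proof.
case: b1 => // x b1 -> _; rewrite nth_cat /= ltnSn.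
by rewrite -(last_nth 0).
Qed.

Lemma filter_block (T : eqType) (w1 w2 : seq T) q y : y \notin w1 -> y \notin w2 ->
  [seq z <- w1 ++ nseq q y ++ w2 | z != y] = w1 ++ w2.
Proof.
move=> y1 y2; rewrite !filter_cat; congr (_ ++ _).
  by apply/all_filterP/allP => z z1; apply: contraNneq y1 => <-.
rewrite (eq_in_filter (a2 := pred0)) ?filter_pred0.
  by apply/all_filterP/allP => z z1; apply: contraNneq y2 => <-.
by move=> z; rewrite mem_nseq => /andP[_ /eqP->]; rewrite eqxx.
Qed.

(** Removing interval blocks one at a time gives the same value as the evaluation
    from the outer block: each removal preserves the latter, by [outer_first]
    and [outer_remove]. *)
Lemma hat_rec_outer (T : eqType) k (w : seq T) s t :
  noncrossing_word w -> tree_shape t w -> (0 < size w <= k)%N ->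
  size s = size w ->
  hat_rec al k (unzip1 s) w (take (size s).-1 (unzip2 s)) * last 1 (unzip2 s)
    = eval_block (outer_block t s).
Proof.
elim: k w s t => [|k IHk] w s t nc sh w_le szs; first by lia.
rewrite /=; case: ifP => [w_const|w_nconst].
  case: w w_const {nc} sh w_le szs => // x0 w0; set w := x0 :: w0 => w_const sh _ szs.
  have /(constantP x0)[x def_w] := w_const.
  rewrite -[w]cats0 def_w in sh; rewrite -[s in RHS]cats0.
  have [//|//|||t' /tree_shape_nil-> ->] // := @outer_first _ t (size w) x [::] s [::] sh.
  by rewrite mul_last1; case: (s) szs.
have w_n0 : w != [::] by apply: contraTneq w_le => ->.
case def_f: [seq x <- w | interval_label w x] => [|y f].
  have [y y_w int_y] := interval_ex nc w_n0.
  have : y \in [seq x <- w | interval_label w x] by rewrite mem_filter int_y.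
  by rewrite def_f.
have : y \in [seq x <- w | interval_label w x] by rewrite def_f mem_head.
rewrite mem_filter => /andP[int_y y_w] {def_f f}.
have [w1 [q [w2 [def_w q_gt0 y1 y2]]]] := interval_labelP y_w int_y.
rewrite def_w in nc sh w_le szs w_nconst *.
rewrite index_block // count_block // filter_block //.
rewrite !size_cat size_nseq in szs w_le *.
have [s1 [sY [s2 [def_s sz1 szY sz2]]]] : exists s1 sY s2,
    [/\ s = s1 ++ sY ++ s2, size s1 = size w1, size sY = q & size s2 = size w2].
  exists (take (size w1) s), (take q (drop (size w1) s)), (drop q (drop (size w1) s)).
  by rewrite !cat_take_drop; split=> //; rewrite ?size_take_min ?size_drop; lia.
have sY_n0 : sY <> [::] by move=> sY0; rewrite sY0 /= in szY; lia.
have nc' : noncrossing_word (w1 ++ w2) by exact: noncrossing_del nc.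
have w'_gt0 : (0 < size (w1 ++ w2))%N.
  rewrite lt0n size_eq0; apply: contraFneq w_nconst => w12_0.
  have -> : w1 = [::] by case: (w1) w12_0.
  have -> : w2 = [::] by case: (w1) w12_0.
  by rewrite cats0 constant_nseq.
have le_k : (0 < size (w1 ++ w2) <= k)%N by rewrite w'_gt0 size_cat; lia.
case: eqVneq => [w10|w1_n0].
  have {}w10 : w1 = [::] by apply: size0nil.
  have s10 : s1 = [::] by apply: size0nil; rewrite sz1 w10.
  have s2_n0 : s2 <> [::].
    by move=> s20; move: w'_gt0; rewrite w10 /= -sz2 s20.
  rewrite w10 s10 /= in def_s nc' w'_gt0 le_k sh *.
  have [t' sh' eq_o] := outer_first sh q_gt0 y2 szY sz2.
  rewrite def_s eq_o eval_block_mul_last // -(IHk w2) // take_unzip2 //.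
  have eY : eval_block sY = al (unzip1 sY) (take q.-1 (unzip2 sY)) * last 1 (unzip2 sY).
    by rewrite -szY; case: (sY) sY_n0.
  have u_n0 : unzip2 sY <> [::] by case: (sY) sY_n0.
  rewrite add0n drop0 (nth_last_cat _ (n := q)) ?size_map // eY.
  rewrite /unzip1 /unzip2 !map_cat !drop_size_cat ?size_map //.
  rewrite (@take_size_cat _ q) ?size_map // takel_cat ?size_map; last by lia.
  by case: (s2) s2_n0 => // x s2' _; rewrite last_cat take0 /= !mulrA.
have s1_n0 : s1 <> [::] by case: (s1) sz1 w1_n0 => // <-.
have b1_n0 : unzip2 s1 <> [::] by case: (s1) s1_n0.
have w1_n0' : w1 <> [::] by case: (w1) w1_n0.
have [t' sh' eq_o] := outer_remove sh erefl w1_n0' q_gt0 y1 y2 sz1 szY sz2.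
rewrite def_s eq_o -(IHk (w1 ++ w2)) //; last by rewrite !size_cat size_mul_last sz1 sz2.
have eY : eval_block sY = al (unzip1 sY) (take q.-1 (unzip2 sY)) * last 1 (unzip2 sY).
  by rewrite -szY; case: (sY) sY_n0.
have u_n0 : unzip2 sY <> [::] by case: (sY) sY_n0.
have u1E c : unzip1 (mul_last c s1 ++ s2) = unzip1 s1 ++ unzip1 s2.
  by rewrite /unzip1 map_cat -!/(unzip1 _) unzip1_mul_last.
have unzip1_cat (s3 s4 : seq (I * B)) : unzip1 (s3 ++ s4) = unzip1 s3 ++ unzip1 s4.
  exact: map_cat.
have unzip2_cat (s3 s4 : seq (I * B)) : unzip2 (s3 ++ s4) = unzip2 s3 ++ unzip2 s4.
  exact: map_cat.
have szu1 (s3 : seq (I * B)) : size (unzip1 s3) = size s3 by exact: size_map.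
have szu2 (s3 : seq (I * B)) : size (unzip2 s3) = size s3 by exact: size_map.
have le_w1 : ((size w1).-1 <= size (unzip2 s1))%N by rewrite szu2 sz1 leq_pred.
have last_sY (b : B) : last b (unzip2 sY) = last 1 (unzip2 sY) by case: (sY) sY_n0.
rewrite addnA; case: eqVneq => [w20|w2_n0].
  have s20 : s2 = [::] by apply: size0nil; lia.
  have w20' : w2 = [::] by apply: size0nil; lia.
  rewrite s20 w20' !cats0 take_unzip2 // unzip1_mul_last size_mul_last.
  rewrite takel_cat // unzip2_mul_last // last_rcons -cats1 take_size_cat; last first.
    by rewrite size_takel // szu2 leq_pred.
  rewrite nth_last_cat ?szu2 // unzip1_cat unzip2_cat.
  rewrite !(@drop_size_cat _ (size w1)) ?szu1 ?szu2 // take_size_cat ?szu1 //.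
  rewrite drop_oversize ?cats0; last by rewrite size_cat !szu1 sz1 szY.
  by rewrite (@take_oversize _ q) ?szu1 ?szY // last_cat last_sY sz1 eY !mulrA.
have s2_n0 : s2 <> [::] by case: (s2) sz2 w2_n0 => //= <-; rewrite addn0 eqxx.
have last_s2 (b : B) : last b (unzip2 s2) = last 1 (unzip2 s2) by case: (s2) s2_n0.
rewrite u1E catA !take_unzip2 // unzip2_mul_last //.
rewrite !unzip1_cat !unzip2_cat !last_cat.
congr (_ * _); last by rewrite last_s2 [RHS]last_s2.
have -> : take (size w1) ((unzip1 s1 ++ unzip1 sY) ++ unzip1 s2) = unzip1 s1.
  by rewrite -catA take_size_cat ?szu1.
have -> : drop (size w1 + q) ((unzip1 s1 ++ unzip1 sY) ++ unzip1 s2) = unzip1 s2.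
  by rewrite drop_size_cat // size_cat !szu1 sz1 szY.
have -> : take q (drop (size w1) ((unzip1 s1 ++ unzip1 sY) ++ unzip1 s2)) = unzip1 sY.
  by rewrite -catA drop_size_cat ?szu1 // take_size_cat ?szu1.
set b2 := take (size s2).-1 (unzip2 s2).
have -> : nth 0 ((unzip2 s1 ++ unzip2 sY) ++ b2) (size w1 + q).-1 = last 1 (unzip2 sY).
  rewrite nth_last_cat ?last_cat ?size_cat ?szu2 ?sz1 ?szY //.
  by case: (unzip2 s1) b1_n0.
have -> : drop (size w1 + q) ((unzip2 s1 ++ unzip2 sY) ++ b2) = b2.
  by rewrite drop_size_cat // size_cat !szu2 sz1 szY.
rewrite -!catA takel_cat // nth_last_cat ?szu2 // drop_size_cat ?szu2 //.
rewrite takel_cat ?szu2 ?szY ?leq_pred // cat_rcons sz1 eY.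
by rewrite !mulrA.
Qed.

End Outer.

(** * Moments as sums over the outer block; additivity of the cumulants *)

Local Open Scope ring_scope.

Section Moments.
Variables (C : numClosedFieldType) (B A : algType C).
Variables (iota : {lrmorphism B -> A}) (E : {linear A -> B}).
Hypothesis E_iota : forall b, E (iota b) = b.
Hypothesis E_modr : forall x b, E (x * iota b) = E x * b.
Variables (I : Type) (a_ : I -> A).
Implicit Types s : seq (I * B).

Definition moment s : B := E (\prod_(x <- s) (a_ x.1 * iota x.2)).

Local Notation kappa := (cumulant iota E a_).
Local Notation eval_k := (eval_block kappa).
Local Notation outerk := (outer_block kappa).

Lemma moment_nil : moment [::] = 1.
Proof. by rewrite /moment big_nil -(rmorph1 iota) E_iota. Qed.

Lemma moment_word s : s <> [::] ->
  moment s = E (word iota a_ (unzip1 s) (take (size s).-1 (unzip2 s)))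
             * last 1 (unzip2 s).
Proof.
case: s => // -[i b] s _; rewrite /moment -E_modr; congr (E _) => /=.
elim: s i b => [|[i' b'] s IHs] i b; rewrite big_cons.
  by rewrite /= !big_nil !mulr1.
by rewrite IHs /= [in RHS]big_cons /= !mulrA.
Qed.

(** The moment-cumulant formula, with the coefficients of the blocks gathered. *)
Lemma moment_sum_trees s :
  moment s = \sum_(t <- trees (size s)) eval_k (outerk t s).
Proof.
have [->|s_n0] : s = [::] \/ s <> [::] by case: s => [|? ?]; [left|right].
  by rewrite moment_nil big_trees0.
have sz : size s = size (unzip1 s) by rewrite size_map.
rewrite moment_word // moment_cumulant; last by rewrite -sz; case: (s) s_n0.
rewrite mulr_suml [in RHS]sz; apply: sum_NC => P t _ nc sh.
apply: hat_rec_outer => //; rewrite size_labels -sz // leqnn andbT.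
by case: (s) s_n0.
Qed.

(** Additivity of a map in one coefficient is stated on the triples of words that
    it relates, because this relation is inherited by outer blocks. *)
Definition split_at s s1 s2 := exists c1 i b1 b2 c2,
  [/\ s = c1 ++ (i, b1 + b2) :: c2, s1 = c1 ++ (i, b1) :: c2
    & s2 = c1 ++ (i, b2) :: c2].

Lemma moment_split s s1 s2 : split_at s s1 s2 -> moment s = moment s1 + moment s2.
Proof.
case=> [c1 [i [b1 [b2 [c2 [-> -> ->]]]]]]; rewrite /moment -linearD /=.
by rewrite !big_cat !big_cons /= rmorphD mulrDr mulrDl mulrDr.
Qed.

Lemma size_outer t s : nodes t = size s -> size (outerk t s) = spine t.
Proof.
elim: t s => [|u _ v IHv] [|[i b] s] //= [sz].
by rewrite IHv // size_drop -sz addKn.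
Qed.

Lemma outer_comb s : outerk (comb (size s)) s = s.
Proof. by elim: s => //= -[i b] s IHs /=; rewrite drop0 IHs mulr1. Qed.

(** The coefficient that is split either belongs to the outer block or is inside
    a gap; in the second case the value of the gap is additive by hypothesis,
    and the sum appears in the coefficient that absorbs it. *)
Lemma outer_split n t s s1 s2 :
  (forall s s1 s2, split_at s s1 s2 -> (size s < n)%N ->
     eval_k s = eval_k s1 + eval_k s2) ->
  nodes t = size s -> (size s <= n)%N -> split_at s s1 s2 ->
  split_at (outerk t s) (outerk t s1) (outerk t s2).
Proof.
move=> addk; elim: t s s1 s2 => [|u IHu v IHv] s s1 s2 /= sz le_n.
  by case=> [[|? ?] [i [b1 [b2 [c2 [def_s _ _]]]]]]; rewrite def_s in sz.
case=> [[|[i0 b0] c1] [i [b1 [b2 [c2 [def_s -> ->]]]]]].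
  rewrite def_s /= mulrDl; exists [::], i; do 3!eexists; split; first by [].
    by [].
  by [].
rewrite def_s /= in sz le_n *; case: sz => sz.
have [lt_u|le_u] := ltnP (size c1) (nodes u).
  have sz_u : nodes u = size (take (nodes u) (c1 ++ (i, b1 + b2) :: c2)).
    by rewrite size_takel // -sz leq_addr.
  have sp : split_at (take (nodes u) (c1 ++ (i, b1 + b2) :: c2))
     (take (nodes u) (c1 ++ (i, b1) :: c2)) (take (nodes u) (c1 ++ (i, b2) :: c2)).
    rewrite !take_cat ltnNge (ltnW lt_u) /= -subnSK //=.
    by do 5!eexists; split.
  have lt_n : (nodes u < n)%N by apply: leq_trans le_n; rewrite -sz ltnS leq_addr.
  have IH := IHu _ _ _ sz_u _ sp; rewrite -sz_u in IH.
  have dropE b : drop (nodes u) (c1 ++ (i, b) :: c2) = drop (nodes u - (size c1).+1) c2.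
    by rewrite drop_cat ltnNge (ltnW lt_u) /= -subnSK.
  rewrite !dropE (addk _ _ _ (IH (ltnW lt_n))) ?mulrDr.
    by exists [::], i0; do 3!eexists; split.
  by rewrite size_outer // (leq_ltn_trans (spine_le u)).
have takeE b : take (nodes u) (c1 ++ (i, b) :: c2) = take (nodes u) c1.
  by rewrite takel_cat.
have dropE b : drop (nodes u) (c1 ++ (i, b) :: c2) = drop (nodes u) c1 ++ (i, b) :: c2.
  rewrite drop_cat; case: ltngtP le_u => // -> _.
  by rewrite subnn drop0 drop_size.
have sz_v : nodes v = size (drop (nodes u) (c1 ++ (i, b1 + b2) :: c2)).
  by rewrite size_drop -sz addKn.
rewrite !takeE.
have [||d1 [i' [x1 [x2 [d2 [-> -> ->]]]]]] := IHv _
  (drop (nodes u) (c1 ++ (i, b1) :: c2)) (drop (nodes u) (c1 ++ (i, b2) :: c2)) sz_v.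
- by rewrite -sz_v; apply: leq_trans le_n; rewrite -sz ltnW // ltnS leq_addl.
- by rewrite !dropE; do 5!eexists; split.
by rewrite -cat_cons; do 5!eexists; split; rewrite -?cat_cons.
Qed.

(** The cumulants are additive in each argument, by induction on the length: the
    cumulant is the moment, which is additive, minus the contributions of the
    other partitions, which have a shorter outer block and inner blocks that are
    shorter too. *)
Lemma eval_k_split s s1 s2 : split_at s s1 s2 -> eval_k s = eval_k s1 + eval_k s2.
Proof.
have [n] := ubnP (size s); elim: n s s1 s2 => // n IHn s s1 s2; rewrite ltnS => le_n sp.
have [sz1 sz2] : size s1 = size s /\ size s2 = size s.
  by case: (sp) => [c1 [i [b1 [b2 [c2 [-> -> ->]]]]]]; rewrite !size_cat.
have momE s' : size s' = size s -> eval_k s' =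
    moment s' - \sum_(t <- trees (size s) | t != comb (size s)) eval_k (outerk t s').
  move=> sz'; rewrite moment_sum_trees sz' (bigD1_seq (comb (size s))) /=.
  - have -> : outerk (comb (size s)) s' = s' by rewrite -sz' outer_comb.
    by rewrite addrK.
  - by rewrite mem_trees nodes_comb.
  exact: uniq_trees.
rewrite !momE // (moment_split sp) addrACA -opprD -big_split /=; congr (_ - _).
rewrite big_seq_cond [RHS]big_seq_cond; apply: eq_bigr => t /andP[].
rewrite mem_trees => /eqP sz_t t_comb.
have add_lt s0 s3 s4 : split_at s0 s3 s4 -> (size s0 < size s)%N ->
    eval_k s0 = eval_k s3 + eval_k s4.
  by move=> sp0 lt0; apply: IHn sp0; apply: leq_trans le_n.
apply: (add_lt); first exact: (outer_split add_lt).
rewrite size_outer // -sz_t ltn_neqAle spine_le andbT.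
by apply: contraNneq t_comb => /spine_comb; rewrite sz_t => ->.
Qed.

Lemma eval_k_add c1 i b1 b2 c2 : eval_k (c1 ++ (i, b1 + b2) :: c2) =
  eval_k (c1 ++ (i, b1) :: c2) + eval_k (c1 ++ (i, b2) :: c2).
Proof. by apply: eval_k_split; exists c1, i, b1, b2, c2. Qed.

Lemma eval_k0 c1 i c2 : eval_k (c1 ++ (i, 0) :: c2) = 0.
Proof.
by apply: (addrI (eval_k (c1 ++ (i, 0) :: c2))); rewrite -eval_k_add !addr0.
Qed.

Lemma eval_k_sum (J : Type) (r : seq J) (f : J -> B) c1 i c2 :
  eval_k (c1 ++ (i, \sum_(x <- r) f x) :: c2) =
  \sum_(x <- r) eval_k (c1 ++ (i, f x) :: c2).
Proof.
elim: r => [|x r IHr]; first by rewrite !big_nil eval_k0.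
by rewrite !big_cons eval_k_add IHr.
Qed.

(** The sum over all ways to continue through [s] an outer block whose part [acc]
    is already known, gaps included. *)
Definition open_sum acc s :=
  \sum_(t <- trees (size s)) eval_k (acc ++ outerk t s).

Lemma moment_open_sum s : moment s = open_sum [::] s.
Proof. exact: moment_sum_trees. Qed.

Lemma open_sum_nil acc : open_sum acc [::] = eval_k acc.
Proof. by rewrite /open_sum big_trees0 cats0. Qed.

(** The next letter joins the outer block and [k] is the length of the gap after
    it. By additivity, the sum over the partitions of the gap replaces the value
    of the gap by its moment. *)
Lemma open_sum_cons acc i b s : open_sum acc ((i, b) :: s) =
  \sum_(k < (size s).+1)
     open_sum (rcons acc (i, b * moment (take k s))) (drop k s).
Proof.
rewrite /open_sum /= big_treesS; apply: eq_bigr => k _.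
have szk : size (take k s) = k by rewrite size_takel // -ltnS.
rewrite exchange_big /= size_drop; apply: eq_bigr => v _.
rewrite cat_rcons moment_sum_trees szk mulr_sumr eval_k_sum.
by rewrite !big_seq; apply: eq_bigr => u; rewrite mem_trees => /eqP->.
Qed.

End Moments.

(** * Substitution of series into multilinear maps *)

Lemma sum_triangle (V : nmodType) d (h : nat -> nat -> V) :
  \sum_(e < d.+1) \sum_(i < (d - e).+1) h e i =
  \sum_(j < d.+1) \sum_(e < j.+1) h e (j - e)%N.
Proof.
elim: d => [|d IHd]; first by rewrite !big_ord1.
rewrite [LHS]big_ord_recr [RHS]big_ord_recr /= -IHd subnn big_ord1.
rewrite [X in _ = _ + X]big_ord_recr /= subnn addrA -big_split /=; congr (_ + _).
by apply: eq_bigr => e _; rewrite subSn -1?ltnS // big_ord_recr.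
Qed.

Section Nested.
Variables (C : numClosedFieldType) (B : algType C).

(** The degree-[d] part of [phi] evaluated at the series [v x], for [x] in [r],
    as an iterated sum over the degree of one series after the other. The
    series are indexed so that equal ones may be given by the same index. *)
Fixpoint nested_sum (J : Type) (v : J -> nat -> B) (phi : seq B -> B)
    (r : seq J) (d : nat) : B :=
  if r is x :: r' then
    \sum_(e < d.+1) nested_sum v (fun bs => phi (v x e :: bs)) r' (d - e)
  else if d == 0%N then phi [::] else 0.

Lemma eq_nested_sum (J : Type) (v v' : J -> nat -> B) phi phi' r d :
  (forall x e, v x e = v' x e) ->
  (forall bs, size bs = size r -> phi bs = phi' bs) ->
  nested_sum v phi r d = nested_sum v' phi' r d.
Proof.
move=> eq_v; elim: r phi phi' d => [|x r IHr] phi phi' d eq_phi /=.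
  by rewrite eq_phi.
by apply: eq_bigr => e _; apply: IHr => bs sz; rewrite eq_v eq_phi //= sz.
Qed.

Lemma nested_sum_map (J K : Type) (g : K -> J) (v : J -> nat -> B) phi r d :
  nested_sum v phi (map g r) d = nested_sum (fun x => v (g x)) phi r d.
Proof. by elim: r phi d => //= x r IHr phi d; apply: eq_bigr => e _. Qed.

Lemma nested_sum0 (J : Type) (v : J -> nat -> B) phi r d :
  (forall bs, size bs = size r -> phi bs = 0) -> nested_sum v phi r d = 0.
Proof.
elim: r phi d => [|x r IHr] phi d phi0 /=; first by rewrite phi0 // if_same.
by apply: big1 => e _; apply: IHr => bs sz; rewrite phi0 //= sz.
Qed.

(** A last argument on which [phi] acts by right multiplication gives a product
    of series. *)
Lemma nested_sum_rcons (J : Type) (v : J -> nat -> B) phi psi r x d :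
  (forall bs b, size bs = size r -> phi (rcons bs b) = psi bs * b) ->
  nested_sum v phi (rcons r x) d =
  \sum_(i < d.+1) nested_sum v psi r i * v x (d - i)%N.
Proof.
elim: r phi psi d => [|y r IHr] phi psi d phiE /=.
  rewrite big_ord_recr /= subnn eqxx big1 ?add0r => [|i _]; last first.
    by rewrite subn_eq0 leqNgt ltn_ord.
  rewrite big_ord_recl /= subn0 big1 ?addr0 => [|i _]; last by rewrite mul0r.
  exact: (phiE [::]).
transitivity (\sum_(e < d.+1) \sum_(i < (d - e).+1)
    nested_sum v (fun bs => psi (v y e :: bs)) r i * v x (d - e - i)%N).
  apply: eq_bigr => e _; apply: IHr => bs b sz.
  by rewrite -rcons_cons phiE //= sz.
rewrite (sum_triangle d (fun e i =>
  nested_sum v (fun bs => psi (v y e :: bs)) r i * v x (d - e - i)%N)).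
apply: eq_bigr => j _; rewrite mulr_suml; apply: eq_bigr => e _.
by rewrite -subnDA subnKC // -ltnS.
Qed.

(** A product of n series of odd degrees has degrees of the parity of n. *)
Lemma nested_sum_parity (J : Type) (v : J -> nat -> B) phi r d :
  (forall bs1 bs2, (size bs1 + size bs2).+1 = size r -> phi (bs1 ++ 0 :: bs2) = 0) ->
  (forall x e, ~~ odd e -> v x e = 0) ->
  odd d != odd (size r) -> nested_sum v phi r d = 0.
Proof.
move=> + v_even; elim: r phi d => [|x r IHr] phi d phi0 /=.
  by case: d.
move=> neq_d; apply: big1 => e _; have [e_odd|e_even] := boolP (odd e).
  apply: IHr => [bs1 bs2 sz|]; first by rewrite -cat_cons phi0 //= addSn sz.
  move: neq_d; rewrite oddB; last by rewrite -ltnS.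
  by rewrite e_odd; case: (odd d); case: (odd (size r)).
by apply: nested_sum0 => bs sz; rewrite v_even // (phi0 [::]) //= sz.
Qed.

(** The bound [D] on the degrees is separated from the total degree [d], because
    it stays the same in the induction while [d] decreases. *)
Lemma fps_subst_nested_gen D al (ss : seq (fps B)) d b1 b2 : (d <= D)%N ->
  \sum_(e : (size ss).-tuple 'I_D.+1 | (\sum_(i <- e) i == d)%N)
     al [seq x.1 (nat_of_ord x.2) b1 b2 | x <- zip ss e] =
  nested_sum (fun s e => s e b1 b2) al ss d.
Proof.
elim: ss al d => [|s ss IHss] al d le_dD /=.
  case: eqP => [->|d_n0].
    rewrite (big_pred1 [tuple]) => [|e] //=.
    by rewrite (tuple0 e) [RHS]eqxx big_nil.
  by rewrite big_pred0 // => e; rewrite (tuple0 e) big_nil; apply/eqP/nesym.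
rewrite (reindex (fun p : 'I_D.+1 * (size ss).-tuple 'I_D.+1 =>
  [tuple of p.1 :: p.2])) /=; last first.
  exists (fun e => (thead e, [tuple of behead e])) => [[e0 e] _|e _] /=.
    by congr (_, _); apply: val_inj.
  by rewrite [RHS]tuple_eta.
rewrite (eq_bigl (fun p : 'I_D.+1 * (size ss).-tuple 'I_D.+1 =>
  (p.1 < d.+1)%N && (\sum_(i <- p.2) i == d - p.1)%N)); last first.
  by move=> [e0 e] /=; rewrite big_cons; apply/eqP/andP => [|[? /eqP]]; lia.
rewrite -(pair_big_dep (fun e0 : 'I_D.+1 => (e0 < d.+1)%N)
  (fun (e0 : 'I_D.+1) (e : (size ss).-tuple 'I_D.+1) => (\sum_(i <- e) i == d - e0)%N)
  (fun e0 e => al [seq x.1 (nat_of_ord x.2) b1 b2 | x <- zip (s :: ss) (e0 :: e)])) /=.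
rewrite (big_ord_widen_cond D.+1 xpredT (fun e =>
  nested_sum (fun s e => s e b1 b2) (fun bs => al (s e b1 b2 :: bs)) ss (d - e))) //=.
apply: eq_bigr => e0 _; rewrite -IHss //.
exact: leq_trans (leq_subr _ _) le_dD.
Qed.

Lemma fps_subst_nested al (ss : seq (fps B)) d b1 b2 :
  fps_subst al ss d b1 b2 = nested_sum (fun s e => s e b1 b2) al ss d.
Proof. exact: fps_subst_nested_gen. Qed.

Lemma fps_mul_b1 (s : fps B) d b1 b2 :
  fps_mul fps_b1 s d b1 b2 = if d is d'.+1 then b1 * s d' b1 b2 else 0.
Proof.
rewrite /fps_mul; case: d => [|d]; first by rewrite big_ord1 mul0r.
rewrite 2!big_ord_recl /= mul0r add0r big1 ?addr0 => [|i _]; last by rewrite mul0r.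
by rewrite /bump /= subSS subn0.
Qed.

Lemma fps_mul_b2 (s : fps B) d b1 b2 :
  fps_mul fps_b2 s d b1 b2 = if d is d'.+1 then b2 * s d' b1 b2 else 0.
Proof.
rewrite /fps_mul; case: d => [|d]; first by rewrite big_ord1 mul0r.
rewrite 2!big_ord_recl /= mul0r add0r big1 ?addr0 => [|i _]; last by rewrite mul0r.
by rewrite /bump /= subSS subn0.
Qed.

End Nested.

(** * Alternating words *)

Fixpoint alt_letters (c : bool) (n : nat) : seq bool :=
  if n is n'.+1 then c :: alt_letters (~~ c) n' else [::].

Lemma size_alt_letters c n : size (alt_letters c n) = n.
Proof. by elim: n c => //= n IHn c; rewrite IHn. Qed.

Lemma alt_lettersE c n : alt_letters c n = mkseq (fun i => odd i (+) c) n.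
Proof.
elim: n c => // n IHn c; rewrite /= IHn /mkseq /= (iotaDl 1 0) -map_comp.
by congr (_ :: _); apply: eq_map => i /=; case: (odd i) c => [] [].
Qed.

Lemma alt_letters_take c k n : (k <= n)%N ->
  take k (alt_letters c n) = alt_letters c k.
Proof. by elim: k n c => [|k IHk] [|n] c //= le_kn; rewrite IHk. Qed.

Lemma alt_letters_drop c k n : 
  drop k (alt_letters c n) = alt_letters (odd k (+) c) (n - k).
Proof.
elim: k n c => [|k IHk] [|n] c //=; rewrite IHk subSS.
by case: (odd k); case: c.
Qed.

Lemma alt_letters_rcons c n : ~~ odd n ->
  alt_letters c n.+2 = rcons (alt_letters c n.+1) (~~ c).
Proof.
move=> n_even; rewrite !alt_lettersE {1}/mkseq -[n.+2]addn1 iotaD map_cat cats1.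
by rewrite /= (negPf n_even).
Qed.

Section Alternating.
Variables (C : numClosedFieldType) (B A : algType C).
Variables (iota : {lrmorphism B -> A}) (E : {linear A -> B}).
Hypothesis E_iota : forall b, E (iota b) = b.
Hypothesis E_modr : forall x b, E (x * iota b) = E x * b.
Variables (a_ : bool -> A) (beta : bool -> B).

Definition alt_word c n := [seq (l, beta l) | l <- alt_letters c n].

Definition alt_moment c n := moment iota E a_ (alt_word c n).

Hypothesis alt_moment_odd : forall c n, odd n -> alt_moment c n = 0.

(** The two kinds of arguments in the identities: for words that start with a,
    with [beta] equal to b1 at a and to b2 at the other letter, these are
    b1 G(b2, b1) when [c] is a and b2 F(b1, b2) otherwise. A letter [c] of the outer block in an alternating word is followed
    by a gap that starts with the other letter. *)
Definition alt_series c e := if e is e'.+1 then beta c * alt_moment (~~ c) e' else 0.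

Local Notation kappa := (cumulant iota E a_).
Local Notation eval_k := (eval_block kappa).

Lemma size_alt_word c n : size (alt_word c n) = n.
Proof. by rewrite size_map size_alt_letters. Qed.

Lemma open_sum_zero acc l s : open_sum iota E a_ (rcons acc (l, 0)) s = 0.
Proof. by apply: big1 => t _; rewrite cat_rcons eval_k0. Qed.

Lemma eval_k_zip0 acc ls bs1 bs2 :
  (size bs1 + size bs2).+1 = size ls -> eval_k (acc ++ zip ls (bs1 ++ 0 :: bs2)) = 0.
Proof.
move=> sz; rewrite -(cat_take_drop (size bs1) ls).
rewrite zip_cat; last by rewrite size_takel // -sz -addnS leq_addr.
case def_l: (drop (size bs1) ls) => [|l ls'].
  by have := size_drop (size bs1) ls; rewrite def_l -sz -addnS addKn.
by rewrite /= catA eval_k0.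
Qed.

(** Iterating [open_sum_cons] expands an alternating word into the possible numbers
    [k] of letters of the outer block and lengths of gaps. Gaps of odd length
    contribute zero; the others have even length, which is why the letters of
    the outer block alternate too. *)
Lemma alt_open_sum acc c N K : (N < K)%N ->
  open_sum iota E a_ acc (alt_word c N) =
  \sum_(k < K) nested_sum alt_series
     (fun bs => eval_k (acc ++ zip (alt_letters c k) bs)) (alt_letters c k) N.
Proof.
elim/ltn_ind: N acc c K => N IHN acc c [//|K]; rewrite ltnS => le_NK.
rewrite big_ord_recl /= exchange_big /=.
case: N IHN le_NK => [|n] IHN le_NK.
  rewrite cats0 open_sum_nil big_ord1 big1 ?addr0 // => k _.
  by apply: nested_sum0 => bs sz; rewrite eval_k0.
rewrite add0r big_ord_recl /= big1 ?add0r => [|k _]; last first.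
  by apply: nested_sum0 => bs sz; rewrite eval_k0.
rewrite open_sum_cons // -/(alt_word _ _) size_alt_word; apply: eq_bigr => e _.
have le_en : (e <= n)%N by rewrite -ltnS.
rewrite /bump /= add1n subSS -map_take -map_drop alt_letters_take //.
rewrite alt_letters_drop -!/(alt_word _ _) -!/(alt_moment _ _).
transitivity (open_sum iota E a_ (rcons acc (c, beta c * alt_moment (~~ c) e))
                (alt_word (~~ c) (n - e))).
  (* After an odd gap the next letter is again [c], but the term vanishes. *)
  case e_odd: (odd e) => //=; by rewrite alt_moment_odd // mulr0 !open_sum_zero.
rewrite (IHN (n - e)%N _ _ _ K); [|lia|lia].
apply: eq_bigr => k _; apply: eq_nested_sum => // bs _.
by rewrite cat_rcons.
Qed.

Lemma alt_series_even c e : ~~ odd e -> alt_series c e = 0.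
Proof.
by case: e => //= e; rewrite negbK => e_odd; rewrite alt_moment_odd ?mulr0.
Qed.

(** The contribution of the outer blocks with [k] letters in degree [d]. *)
Definition alt_term c k d := nested_sum alt_series
  (fun bs => eval_k (zip (alt_letters c k) bs)) (alt_letters c k) d.

Lemma alt_term_parity c k d : odd d != odd k -> alt_term c k d = 0.
Proof.
move=> neq; apply: nested_sum_parity; rewrite ?size_alt_letters //.
  by move=> bs1 bs2 sz; apply: (eval_k_zip0 [::]); rewrite size_alt_letters.
exact: alt_series_even.
Qed.

(** In an even degree only even [k] contribute, by parity; in an odd degree both
    sides vanish. *)
Lemma alt_momentE c d M : (d <= M)%N ->
  alt_moment c d = (if d == 0%N then 1 else 0) +
    \sum_(1 <= l < M.+1) alt_term c l.*2 d.
Proof.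
move=> le_dM; have alt0 k : alt_term c 0 k = (if k == 0%N then 1 else 0) by [].
have [d_odd|d_even] := boolP (odd d).
  rewrite alt_moment_odd //; case: d d_odd {le_dM} => // d d_odd.
  rewrite add0r big1 // => l _; apply: alt_term_parity.
  by rewrite d_odd odd_double.
rewrite /alt_moment moment_open_sum // (@alt_open_sum _ _ _ (M.+1).*2); last by lia.
rewrite -[LHS]/(\sum_(k < _) alt_term c k d) -alt0.
rewrite -(big_mkord xpredT (fun k => alt_term c k d)).
have -> : alt_term c 0 d + \sum_(1 <= l < M.+1) alt_term c l.*2 d =
    \sum_(0 <= l < M.+1) alt_term c l.*2 d by rewrite [RHS]big_ltn.
elim: (M.+1) => [|m IHm]; first by rewrite !big_geq.
rewrite doubleS !big_nat_recr //= IHm [alt_term c m.*2.+1 d]alt_term_parity ?addr0 //.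
by rewrite (negPf d_even) /= odd_double.
Qed.

(** The coefficient of the last letter of the outer block is the right factor
    b2 F(b1, b2), as the cumulant map has no argument at that place. *)
Lemma alt_term_cumulant_term c l (S T : fps B) b1 b2 d :
  beta c = b1 -> beta (~~ c) = b2 -> (0 < l)%N ->
  (forall e, T e b1 b2 = alt_moment (~~ c) e) ->
  (forall e, S e b1 b2 = alt_moment c e) ->
  alt_term c l.*2 d =
  cumulant_term (fun l => kappa (mkseq (fun i => odd i (+) c) l.*2)) S T l d b1 b2.
Proof.
case: l => // l beta_c beta_nc _ defT defS; rewrite doubleS /cumulant_term /=.
rewrite /alt_term alt_letters_rcons ?odd_double //.
rewrite (nested_sum_rcons _ (psi := kappa (alt_letters c l.*2.+2))); last first.
  move=> bs b; rewrite size_alt_letters => sz; rewrite alt_letters_rcons ?odd_double //.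
  rewrite zip_rcons ?size_alt_letters // eval_block_rcons.
  by rewrite unzip1_zip ?unzip2_zip ?size_alt_letters ?sz.
rewrite {1}/fps_mul; apply: eq_bigr => i _; congr (_ * _); last first.
  rewrite fps_mul_b2; case: (d - i)%N => //= e.
  by rewrite beta_nc negbK defS.
rewrite fps_subst_nested -alt_lettersE doubleS.
have -> : mkseq (fun i => if odd i then fps_mul fps_b2 S else fps_mul fps_b1 T) l.*2.+1
  = [seq (if x == c then fps_mul fps_b1 T else fps_mul fps_b2 S) | x <- alt_letters c l.*2.+1].
  rewrite alt_lettersE -map_comp; apply: eq_map => k /=.
  by case: (odd k); case: (c).
rewrite nested_sum_map; apply: eq_nested_sum => // x e.
case: eqVneq => [->|]; first by rewrite fps_mul_b1; case: e => //= e; rewrite beta_c defT.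
move=> neq; have -> : x = ~~ c by move: neq; case: (x); case: (c).
by rewrite fps_mul_b2; case: e => //= e; rewrite beta_nc negbK defS.
Qed.

Lemma prod_alt_word c n :
  \prod_(x <- alt_word c n.*2) (a_ x.1 * iota x.2) =
  (a_ c * iota (beta c) * a_ (~~ c) * iota (beta (~~ c))) ^+ n.
Proof.
elim: n => [|n IHn]; first by rewrite big_nil.
by rewrite doubleS !big_cons /= negbK -/(alt_word _ _) IHn exprS !mulrA.
Qed.

Lemma moment_seriesE c d b1 b2 : beta c = b1 -> beta (~~ c) = b2 ->
  moment_series iota E (a_ c) (a_ (~~ c)) d b1 b2 = alt_moment c d.
Proof.
move=> <- <-; rewrite /moment_series; case: ifP => [d_odd|d_even].
  by rewrite alt_moment_odd.
by rewrite -{2}[d]odd_double_half d_even /alt_moment /moment prod_alt_word.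
Qed.

End Alternating.

(** * Odd alternating moments and the two identities *)

Lemma mul_exprC (R : pzRingType) (x y : R) n : (x * y) ^+ n * x = x * (y * x) ^+ n.
Proof.
elim: n => [|n IHn]; first by rewrite mulr1 mul1r.
by rewrite exprS -mulrA IHn exprS !mulrA.
Qed.

Section StarAlgebra.
Variables (C : numClosedFieldType) (A : algType C) (star : A -> A).
Hypothesis hstar : star_algebra star.

Lemma star0 : star 0 = 0.
Proof. by apply: (addrI (star 0)); rewrite -(starD hstar) !addr0. Qed.

Lemma star1 : star 1 = 1.
Proof. by rewrite -[LHS]mulr1 -{2}[1](starK hstar) -(starM hstar) mulr1 (starK hstar). Qed.

Lemma starX x n : star (x ^+ n) = star x ^+ n.
Proof.
elim: n => [|n IHn]; first exact: star1.
by rewrite exprS (starM hstar) IHn exprSr.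
Qed.

End StarAlgebra.

Section OddMoments.
Variables (C : numClosedFieldType) (B A : algType C).
Variables (starB : B -> B) (starA : A -> A).
Variables (iota : {lrmorphism B -> A}) (E : {linear A -> B}).
Hypothesis hE : star_ncps starB starA iota E.
Variable a : A.
Hypothesis ha : R_diagonal starA iota E a.

Lemma E_modr x b : E (x * iota b) = E x * b.
Proof.
by have := ncps_E_bimod hE 1 x b; rewrite rmorph1 !mul1r.
Qed.

(** The instance of the first condition on R-diagonal elements in which the
    coefficients alternate between two values. *)
Lemma E_odd_const x y k :
  E (a * (iota x * starA a * iota y * a) ^+ k) = 0.
Proof.
pose bs := flatten (nseq k [:: x; y]).
have sz_bs : size bs == k.*2.
  by rewrite size_flatten /shape map_nseq sumn_nseq mul2n.
rewrite -(R_diagonal_odd ha (Tuple sz_bs)); congr (E _).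
have -> : mkseq odd k.*2.+1 = false :: alt_letters true k.*2.
  rewrite -[RHS]/(alt_letters false k.*2.+1) alt_lettersE.
  by apply: eq_map => i /=; rewrite addbF.
rewrite /word /= /bs; congr (_ * _); clear.
elim: k => [|k IHk]; first by rewrite big_nil.
by rewrite exprS IHk doubleS /= !big_cons /= !mulrA.
Qed.

(** For a word that starts with the adjoint of [a], the star turns it into a word
    that starts with [a]. *)
Lemma alt_moment_odd beta c n : odd n ->
  alt_moment iota E (pair_star starA a) beta c n = 0.
Proof.
rewrite -{2}[n]odd_double_half => -> /=; rewrite add1n.
have prodE : \prod_(z <- alt_word beta c (n./2).*2.+1)
      (pair_star starA a z.1 * iota z.2) =
    pair_star starA a c * (iota (beta c) * pair_star starA a (~~ c) *
       iota (beta (~~ c)) * pair_star starA a c) ^+ n./2 * iota (beta c).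
  rewrite big_cons /= -/(alt_word _ _ _) prod_alt_word negbK.
  by rewrite -[RHS]mulrA -2!(mulrA (iota (beta c))) mul_exprC !mulrA.
rewrite /alt_moment /moment prodE E_modr.
case: c {prodE} => /=; last by rewrite E_odd_const mul0r.
set x := beta true; set y := beta false; set k := n./2.
rewrite -[E _](starK (ncps_starB hE)) -(ncps_E_star hE).
have hA := ncps_starA hE.
rewrite (starM hA) (starX hA) !(starM hA) !(starK hA) -!(ncps_iota_star hE).
have -> : (a * (iota (starB y) * (starA a * iota (starB x)))) ^+ k * a
  = a * (iota (starB y) * starA a * iota (starB x) * a) ^+ k.
  by rewrite mul_exprC !mulrA.
by rewrite E_odd_const (star0 (ncps_starB hE)) mul0r.
Qed.

End OddMoments.

Theorem theorem4p2 (R : realType) (B A : algType R[i])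
    (starB : B -> B) (starA : A -> A)
    (iota : {lrmorphism B -> A}) (E : {linear A -> B})
    (hE : star_ncps starB starA iota E)
    (a : A) (ha : R_diagonal starA iota E a) :
  let alpha1 (l : nat) : seq B -> B :=
    cumulant iota E (pair_star starA a) (mkseq (fun i => odd i) l.*2) in
  let alpha2 (l : nat) : seq B -> B :=
    cumulant iota E (pair_star starA a) (mkseq (fun i => ~~ odd i) l.*2) in
  let F : fps B := moment_series iota E a (starA a) in
  let G : fps B := moment_series iota E (starA a) a in
  fps_sum_from1 F fps_one (cumulant_term alpha1 F (fps_swap G)) /\
  fps_sum_from1 G fps_one (cumulant_term alpha2 G (fps_swap F)).
Proof.
move=> alpha1 alpha2 F G.
pose a_ := pair_star starA a.
(* Both identities are the same one, with [c] the letter that comes first. *)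
pose S c : fps B := moment_series iota E (a_ c) (a_ (~~ c)).
pose alpha c l := cumulant iota E a_ (mkseq (fun i => odd i (+) c) l.*2).
have E_iota := ncps_E_id hE; have Emod := E_modr hE.
suff main c : fps_sum_from1 (S c) fps_one
    (cumulant_term (alpha c) (S c) (fps_swap (S (~~ c)))).
  have alphaE b1 b2 d l c al (U V : fps B) : (forall i, odd i (+) c = al i) ->
      cumulant_term (alpha c) U V l d b1 b2 =
      cumulant_term (fun l => cumulant iota E a_ (mkseq al l.*2)) U V l d b1 b2.
    move=> eq_al; rewrite /cumulant_term /fps_mul; apply: eq_bigr => i _.
    by rewrite /alpha (eq_mkseq eq_al).
  split=> d.
    have [N sumN] := main false d; exists N => M le_NM b1 b2.
    rewrite [LHS](sumN M) //; congr (_ + _); apply: eq_bigr => l _.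
    by apply: alphaE => i; rewrite addbF.
  have [N sumN] := main true d; exists N => M le_NM b1 b2.
  rewrite [LHS](sumN M) //; congr (_ + _); apply: eq_bigr => l _.
  by apply: alphaE => i; rewrite addbT.
move=> d; exists d => M le_dM b1 b2.
pose beta x := if x == c then b1 else b2.
have beta_c : beta c = b1 by rewrite /beta eqxx.
have beta_nc : beta (~~ c) = b2 by rewrite /beta; case: (c).
have odd0 := @alt_moment_odd _ _ _ _ _ _ _ hE _ ha beta.
have SE e : S c e b1 b2 = alt_moment iota E a_ beta c e.
  exact: moment_seriesE.
have TE e : fps_swap (S (~~ c)) e b1 b2 = alt_moment iota E a_ beta (~~ c) e.
  by apply: moment_seriesE => //; rewrite negbK.
rewrite SE (alt_momentE E_iota Emod odd0 c le_dM); congr (_ + _).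
rewrite big_nat_cond [RHS]big_nat_cond; apply: eq_bigr => l /andP[/andP[l_gt0 _] _].
exact: alt_term_cumulant_term.
Qed.
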